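(* There is a randomized polynomial-time algorithm that, given a graph $G=(V,E)$ with edge lengths $\ell_G:E\to\mathbb{R}_{\ge0}$ and terminals $K\subseteq V$ such that the shortest-path metric $d_G$ is $\beta$-decomposable, outputs a (random) minor $H=(K,E_H)$ of $G$ such that $$1\le\frac{\mathbb{E}[d_H(x,y)]}{d_G(x,y)}\le O(\beta\log\beta)\qquad\text{for all } x,y\in K \text{ with } d_G(x,y)>0.$$
   Context: $d_G:V\times V\to\mathbb{R}_{\ge0}$ denotes shortest-path distance in $(G,\ell_G)$ (in particular $G$ is connected). The output graph $H$ on vertex set $K$ carries edge lengths $\ell_H(x,y)=d_G(x,y)$ for $(x,y)\in E_H$, and $d_H$ is its shortest-path distance. A partition $P$ of a metric space $(X,d)$ into disjoint clusters is $\Delta$-bounded if $\max_{u,v\in S}d(u,v)\le\Delta$ for every cluster $S\in P$. The metric $(X,d)$ is $\beta$-decomposable if for every $\Delta>0$ there is a polynomial-time algorithm to sample from a probability distribution $\mu$ over partitions of $X$ such that: every $P\in\mathrm{supp}(\mu)$ is $\Delta$-bounded; and for all $u,v\in X$, $\Pr_{P\sim\mu}[\exists S\in P:\ u\in S,\ v\notin S]\le\beta\, d(u,v)/\Delta$. The $O(\beta\log\beta)$ hides an absolute constant, with the convention $\beta\ge2$. *)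

(* Defs.v *)
From HB Require Import structures.
From mathcomp Require Import all_boot all_order all_algebra.
From mathcomp Require Import all_classical all_reals all_analysis.

Set Implicit Arguments.
Unset Strict Implicit.
Unset Printing Implicit Defensive.

Import Order.TTheory GRing.Theory Num.Theory.

Local Open Scope ring_scope.

(* Probability distributions of finite support, as weighted lists: the
   probability of an outcome is the total weight of its occurrences. *)
Section FiniteDistributions.
Variable R : realType.

Definition fdist (T : Type) := seq (R * T).

Definition fret (T : Type) (x : T) : fdist T := [:: (1, x)].

Definition fbind (T U : Type) (mu : fdist T) (f : T -> fdist U) : fdist U :=
  flatten [seq [seq (p.1 * q.1, q.2) | q <- f p.2] | p <- mu].

Definition fmap (T U : Type) (f : T -> U) (mu : fdist T) : fdist U :=
  [seq (p.1, f p.2) | p <- mu].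

Definition fprob (T : Type) (mu : fdist T) (E : pred T) : R :=
  \sum_(p <- mu | E p.2) p.1.

Definition fexpect (T : Type) (mu : fdist T) (f : T -> \bar R) : \bar R :=
  (\sum_(p <- mu) p.1%:E * f p.2)%E.

Fixpoint almost_surely (T : Type) (mu : fdist T) (P : T -> Prop) : Prop :=
  if mu is p :: mu' then (p.1 != 0 -> P p.2) /\ almost_surely mu' P else True.

End FiniteDistributions.

(* Model of computation: a randomized real RAM, presented as a structured
   imperative language.  A store holds two-dimensional arrays of natural numbers
   and of reals, named by natural numbers; [XGet a i j] reads cell (i, j) of
   array [a].  Naturals only have addition and truncated subtraction, so that
   unit cost per instruction is honest; reals have the exact field operations
   and comparisons but no rounding. *)
Inductive nexp : Type :=
| NConst of nat
| NGet of nat & nexp & nexp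
| NAdd of nexp & nexp
| NSub of nexp & nexp.

Inductive rexp : Type :=
| RNat of nexp
| RGet of nat & nexp & nexp
| RAdd of rexp & rexp
| RSub of rexp & rexp
| RMul of rexp & rexp
| RInv of rexp.

Inductive bexp : Type :=
| NLe of nexp & nexp
| RLe of rexp & rexp
| BNot of bexp
| BAnd of bexp & bexp.

(* [Coin a r] stores in cell (0, 0) of the array [a] of naturals a fresh random
   bit which is 1 with probability [r].
   [Call sz rm rs ans] runs the subroutine of the program in a fresh store, whose
   only nonzero arrays are the array 0 of naturals and the arrays 0 and 1 of
   reals, which are the caller's arrays [sz], [rm] and [rs]; on return, the
   array 1 of naturals of the subroutine becomes the array [ans] of the caller,
   whose store is otherwise unchanged. *)
Inductive cmd : Type :=
| Skip
| NSet of nat & nexp & nexp & nexp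
| RSet of nat & nexp & nexp & rexp
| Seq of cmd & cmd
| If of bexp & cmd & cmd
| While of bexp & cmd
| Coin of nat & rexp
| Call of nat & nat & nat & nat.

Section Machine.
Variable R : realType.

Record store := Store {
  narr : nat -> nat -> nat -> nat;
  rarr : nat -> nat -> nat -> R }.

Definition upd (X : Type) (h : nat -> nat -> nat -> X) (a i j : nat) (x : X) :=
  fun a' i' j' => if [&& a' == a, i' == i & j' == j] then x else h a' i' j'.

Fixpoint neval (m : store) (e : nexp) : nat :=
  match e with
  | NConst k => k
  | NGet a i j => narr m a (neval m i) (neval m j)
  | NAdd e1 e2 => (neval m e1 + neval m e2)%N
  | NSub e1 e2 => (neval m e1 - neval m e2)%N
  end.

Fixpoint reval (m : store) (e : rexp) : R :=
  match e with
  | RNat k => (neval m k)%:R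
  | RGet a i j => rarr m a (neval m i) (neval m j)
  | RAdd e1 e2 => reval m e1 + reval m e2
  | RSub e1 e2 => reval m e1 - reval m e2
  | RMul e1 e2 => reval m e1 * reval m e2
  | RInv e1 => (reval m e1)^-1
  end.

Fixpoint beval (m : store) (b : bexp) : bool :=
  match b with
  | NLe e1 e2 => (neval m e1 <= neval m e2)%N
  | RLe e1 e2 => reval m e1 <= reval m e2
  | BNot b1 => ~~ beval m b1
  | BAnd b1 b2 => beval m b1 && beval m b2
  end.

Definition nset (m : store) (a i j k : nat) : store :=
  Store (upd (narr m) a i j k) (rarr m).

Definition rset (m : store) (a i j : nat) (x : R) : store :=
  Store (narr m) (upd (rarr m) a i j x).

Definition enter (m : store) (sz rm rs : nat) : store :=
  Store (fun a => if a is 0 then narr m sz else fun _ _ => 0%N)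
        (fun a => match a with
                  | 0 => rarr m rm
                  | 1 => rarr m rs
                  | _ => fun _ _ => 0
                  end).

Definition leave (caller sub : store) (ans : nat) : store :=
  Store (fun a => if a == ans then narr sub 1 else narr caller a) (rarr caller).

(* A configuration is a stack of pending commands, together with the current
   store; [Return ans m] resumes the caller, whose store was [m]. *)
Inductive frame : Type :=
| Do of cmd
| Return of nat & store.

Definition config : Type := (seq frame * store)%type.

Definition clamp (r : R) : R := Num.max 0 (Num.min 1 r).

Definition step (sub : cmd) (s : config) : fdist R config :=
  let: (stack, m) := s in
  match stack with
  | [::] => fret R ([::], m)
  | Return ans m0 :: k => fret R (k, leave m0 m ans)
  | Do c :: k =>
    match c with
    | Skip => fret R (k, m)
    | NSet a i j e => fret R (k, nset m a (neval m i) (neval m j) (neval m e))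
    | RSet a i j e => fret R (k, rset m a (neval m i) (neval m j) (reval m e))
    | Seq c1 c2 => fret R (Do c1 :: Do c2 :: k, m)
    | If b c1 c2 => fret R (Do (if beval m b then c1 else c2) :: k, m)
    | While b c1 =>
        fret R (if beval m b then Do c1 :: Do (While b c1) :: k else k, m)
    | Coin a r =>
        let p := clamp (reval m r) in
        [:: (p, (k, nset m a 0 0 1)); (1 - p, (k, nset m a 0 0 0))]
    | Call sz rm rs ans =>
        fret R (Do sub :: Return ans m :: k, enter m sz rm rs)
    end
  end.

Definition run (sub c : cmd) (m : store) (t : nat) : fdist R config :=
  iter t (fun mu => fbind mu (step sub)) (fret R ([:: Do c], m)).

Definition halts_within (sub c : cmd) (m : store) (t : nat) : Prop :=
  almost_surely (run sub c m t) (fun s => s.1 = [::]).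

(* Halted configurations are fixed by [step], so if [c] halts within [t] steps
   then this is the distribution of its final store. *)
Definition outcome (sub c : cmd) (m : store) (t : nat) : fdist R store :=
  fmap snd (run sub c m t).

Definition cell (X : Type) (x0 x : X) (i j : nat) : X :=
  if (i == 0%N) && (j == 0%N) then x else x0.

Definition matr (X : Type) (x0 : X) (n : nat) (f : 'I_n -> 'I_n -> X)
    (i j : nat) : X :=
  match insub i, insub j with
  | Some u, Some v => f u v
  | _, _ => x0
  end.

End Machine.

Section Decomposability.
Variables (R : realType) (n : nat).
Implicit Types (d : 'I_n -> 'I_n -> R) (P : {set {set 'I_n}}).

Definition bounded_partition d (Delta : R) P : Prop :=
  finset.partition P [set: 'I_n]%SET /\
  forall S, S \in P -> forall u v, u \in S -> v \in S -> d u v <= Delta.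

Definition separated P (u v : 'I_n) : bool :=
  [exists S in P, (u \in S) && (v \notin S)].

Definition metric_input d (Delta : R) : store R :=
  Store (fun a => if a is 0 then cell 0%N n else fun _ _ => 0%N)
        (fun a => match a with
                  | 0 => matr 0 d
                  | 1 => cell 0 Delta
                  | _ => fun _ _ => 0
                  end).

(* The clusters are the level sets of u |-> (cell (u, 0) of the array 1). *)
Definition partition_output (m : store R) : {set {set 'I_n}} :=
  preim_partition (fun u : 'I_n => narr m 1 u 0) [set: 'I_n]%SET.

(* [D] is a randomized algorithm that, given ('I_n, d) and Delta, samples from
   [mu] in time p(n). *)
Definition samples (D : cmd) (p : {poly nat}) d (Delta : R)
    (mu : fdist R {set {set 'I_n}}) : Prop :=
  halts_within D D (metric_input d Delta) p.[n] /\
  mu = fmap partition_output (outcome D D (metric_input d Delta) p.[n]).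

(* The sampling algorithm and the polynomial bounding its running time are made
   explicit, as "polynomial time" has no content for a single finite metric. *)
Definition decomposable (D : cmd) (p : {poly nat}) (beta : R) d : Prop :=
  forall Delta : R, 0 < Delta ->
  exists mu : fdist R {set {set 'I_n}},
    [/\ samples D p d Delta mu,
        almost_surely mu (bounded_partition d Delta) &
        forall u v : 'I_n,
          fprob mu (fun P => separated P u v) <= beta * d u v / Delta].

End Decomposability.

Section Graphs.
Variables (R : realType) (n : nat).

Record wgraph := WGraph {
  edge : rel 'I_n;
  len : 'I_n -> 'I_n -> R;
  edge_sym : symmetric edge;
  edge_irr : irreflexive edge;
  len_sym : forall u v, edge u v -> len u v = len v u;
  len_ge0 : forall u v, edge u v -> 0 <= len u v }.

Definition connected_graph (G : wgraph) : Prop :=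
  forall u v, connect (edge G) u v.

Fixpoint walk_len (l : 'I_n -> 'I_n -> R) (u : 'I_n) (s : seq 'I_n) : R :=
  if s is v :: s' then l u v + walk_len l v s' else 0.

(* +oo when there is no walk from u to v *)
Definition spdist (e : rel 'I_n) (l : 'I_n -> 'I_n -> R) (u v : 'I_n) : \bar R :=
  ereal_inf [set (walk_len l u s)%:E | s in [set s | path e u s /\ last u s = v]].

Definition gdist (G : wgraph) (u v : 'I_n) : R :=
  fine (spdist (edge G) (len G) u v).

(* (K, eH) is a minor of G in which a terminal x names the vertex obtained by
   contracting the branch set B x, which contains x. *)
Definition is_minor (G : wgraph) (K : {set 'I_n}) (eH : rel 'I_n) : Prop :=
  [/\ symmetric eH, irreflexive eH,
      forall x y, eH x y -> (x \in K) && (y \in K) &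
      exists B : 'I_n -> {set 'I_n},
      [/\ forall x, x \in K -> x \in B x,
          forall x, x \in K -> forall u v, u \in B x -> v \in B x ->
            connect [rel a b | [&& edge G a b, a \in B x & b \in B x]] u v,
          forall x y, x \in K -> y \in K -> x != y -> [disjoint B x & B y] &
          forall x y, eH x y ->
            exists u v, [/\ u \in B x, v \in B y & edge G u v]]].

Definition graph_input (G : wgraph) (K : {set 'I_n}) : store R :=
  Store (fun a => match a with
                  | 0 => cell 0%N n
                  | 1 => matr 0%N (fun u v => nat_of_bool (edge G u v))
                  | 2 => fun i j => if insub i is Some u
                                    then cell 0%N (nat_of_bool (u \in K)) 0 j
                                    else 0%N
                  | _ => fun _ _ => 0%N
                  end)
        (fun a => if a is 0
                  then matr 0 (fun u v => if edge G u v then len G u v else 0)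
                  else fun _ _ => 0).

Definition out_edge (m : store R) : rel 'I_n :=
  fun x y => narr m 3 x y != 0%N.

Definition out_len (m : store R) (x y : 'I_n) : R := rarr m 1 x y.

Definition out_dist (m : store R) (x y : 'I_n) : \bar R :=
  spdist (out_edge m) (out_len m) x y.

End Graphs.

(* Main.v *)
(** Terminals are assigned to themselves, and the other vertices are assigned to
    terminals at scales r_1 < r_2 < ..., where r_(k+1) is the least distance that is
    at least 2 r_k.  The clusters of a random decomposition of parameter
    r_(k+1) / 2 have diameter at most 2 r_k, since no distance lies strictly between
    2 r_k and r_(k+1); so a vertex assigned at scale k is at distance O(r_k) from its
    terminal, although an edge of length l is cut with probability only
    O(beta l / r_(k+1)).  Choosing the scales among the distances bounds their number
    by n^2, whatever the aspect ratio.  At each scale the unassigned part of every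
    cluster is flooded from its assigned vertices, each connected component from a
    single one.  An edge costs O(beta l) at every scale that can separate its ends;
    such a scale is at least of the order of the distance A from the edge to the
    terminals, and once it exceeds 2 beta A the probability that the edge is still
    unassigned halves at each scale, so O(log beta) scales matter.  The accounting is
    done with an explicit supermartingale. *)

Require Import Defs.
From HB Require Import structures.
From mathcomp Require Import all_boot all_order all_algebra.
From mathcomp Require Import all_classical all_reals all_analysis.
From mathcomp Require Import zify ring lra.

Set Implicit Arguments.
Unset Strict Implicit.
Unset Printing Implicit Defensive.

Import Order.TTheory GRing.Theory Num.Theory.

Local Open Scope ring_scope.

(** * Finite distributions *)

Section FiniteDistributionTheory.
Variable R : realType.

(** Decompositions bound diameters in [d_G] only: a cluster need not induce a connected subgraph, so
    giving a whole cluster to one terminal could disconnect a branch set. Flooding along edges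
    avoids this, but then sharing a cluster with a terminal does not get a vertex assigned. The
    proof uses instead the event that no edge of a shortest path to the nearest terminal is cut; a
    union bound over that path still gives the failure probability [b * A / rp]. A component copies
    one single terminal so that an uncut edge with both ends free costs nothing. The assignment at
    one scale depends on all earlier clusterings, and of [D] only the law of a run from a fresh
    store is known. No joint probability space is built: a bound valid for every current assignment
    is propagated backwards through the steps of the machine. Edges are combined by linearity: a
    shortest walk of [G] between two terminals maps to a walk of [H], so their distance in [H] is at
    most the sum, over its edges, of the distances between the terminals of the two ends. *)

Definition nonneg_weights (T : Type) (mu : fdist R T) : bool :=
  all (fun p => 0 <= p.1) mu.

Lemma fexpect_nil (T : Type) (f : T -> \bar R) : fexpect [::] f = 0%E.
Proof. by rewrite /fexpect big_nil. Qed.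

Lemma fexpect_cons (T : Type) (p : R * T) mu (f : T -> \bar R) :
  fexpect (p :: mu) f = (p.1%:E * f p.2 + fexpect mu f)%E.
Proof. by rewrite /fexpect big_cons. Qed.

Lemma fexpect_cat (T : Type) (mu nu : fdist R T) (f : T -> \bar R) :
  fexpect (mu ++ nu) f = (fexpect mu f + fexpect nu f)%E.
Proof. by rewrite /fexpect big_cat. Qed.

Lemma fexpect_fret (T : Type) (x : T) (f : T -> \bar R) :
  fexpect (fret R x) f = f x.
Proof. by rewrite fexpect_cons fexpect_nil mul1e adde0. Qed.

Lemma fexpect_fmap (T U : Type) (h : T -> U) mu (f : U -> \bar R) :
  fexpect (Defs.fmap h mu) f = fexpect mu (fun x => f (h x)).
Proof. by rewrite /fexpect big_map. Qed.

Lemma fexpect_ge0 (T : Type) mu (f : T -> \bar R) :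
  nonneg_weights mu -> (forall x, 0 <= f x)%E -> (0 <= fexpect mu f)%E.
Proof.
move=> mu0 f0; elim: mu mu0 => [_|p mu IH /andP[p0 mu0]].
  by rewrite fexpect_nil.
by rewrite fexpect_cons adde_ge0 ?IH// mule_ge0// lee_fin.
Qed.

Lemma le_fexpect (T : Type) mu (f g : T -> \bar R) :
  nonneg_weights mu -> almost_surely mu (fun x => f x <= g x)%E ->
  (fexpect mu f <= fexpect mu g)%E.
Proof.
move=> mu0; elim: mu mu0 => [_ _|p mu IH /= /andP[p0 mu0] [fg mufg]].
  by rewrite !fexpect_nil.
rewrite !fexpect_cons leeD ?IH//.
have [->|p10] := eqVneq p.1 0; first by rewrite !mul0e.
by rewrite lee_wpmul2l ?lee_fin// fg.
Qed.

Lemma almost_surelyT (T : Type) (mu : fdist R T) (P : T -> Prop) :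
  (forall x, P x) -> almost_surely mu P.
Proof. by move=> PT; elim: mu => //= p mu IH; split. Qed.

Lemma almost_surely_imp (T : Type) (mu : fdist R T) (P Q : T -> Prop) :
  (forall x, P x -> Q x) -> almost_surely mu P -> almost_surely mu Q.
Proof. by move=> PQ; elim: mu => //= p mu IH [Pp /IH ?]; split=> // /Pp/PQ. Qed.

Lemma almost_surely_and (T : Type) (mu : fdist R T) (P Q : T -> Prop) :
  almost_surely mu P -> almost_surely mu Q ->
  almost_surely mu (fun x => P x /\ Q x).
Proof.
elim: mu => //= p mu IH [Pp Pmu] [Qp Qmu]; split; last exact: IH.
by move=> p0; split; [apply: Pp|apply: Qp].
Qed.

Lemma almost_surely_fmap (T U : Type) (h : T -> U) (mu : fdist R T)
    (P : U -> Prop) :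
  almost_surely (Defs.fmap h mu) P <-> almost_surely mu (fun x => P (h x)).
Proof. by elim: mu => //= p mu IH; split=> -[? /IH ?]; split. Qed.

Lemma fexpect_fbind (T U : Type) mu (nu : T -> fdist R U) (f : U -> \bar R) :
  nonneg_weights mu -> (forall x, nonneg_weights (nu x)) ->
  (forall x, 0 <= f x)%E ->
  fexpect (fbind mu nu) f = fexpect mu (fun x => fexpect (nu x) f).
Proof.
move=> mu0 nu0 f0; elim: mu mu0 => [_|p mu IH /= /andP[p0 mu0]].
  by rewrite /fbind /= !fexpect_nil.
rewrite /fbind /= fexpect_cat fexpect_cons -IH//; congr (_ + _)%E.
elim: (nu p.2) (nu0 p.2) => [_|q l IHl /= /andP[q0 l0]].
  by rewrite !fexpect_nil mule0.
rewrite !fexpect_cons IHl// ge0_muleDr ?mule_ge0 ?fexpect_ge0//.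
by rewrite EFinM muleA.
Qed.

Lemma nonneg_weights_fbind (T U : Type) mu (nu : T -> fdist R U) :
  nonneg_weights mu -> (forall x, nonneg_weights (nu x)) ->
  nonneg_weights (fbind mu nu).
Proof.
move=> mu0 nu0; elim: mu mu0 => //= p mu IH /andP[p0 mu0].
rewrite /nonneg_weights /fbind /= all_cat; apply/andP; split; last exact: IH.
rewrite all_map; apply: sub_all (nu0 p.2) => q /= q0.
by rewrite mulr_ge0.
Qed.

(* A finite expectation of a function equal to [+oo] off [P] forces [P] almost
   surely, since [0 * +oo = 0]. *)
Lemma almost_surely_fexpect (T : Type) mu (P : T -> Prop) (g : T -> \bar R) :
  nonneg_weights mu -> (forall x, 0 <= g x)%E ->
  (fexpect mu (fun x => if `[< P x >] then g x else +oo) < +oo)%E ->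
  almost_surely mu P /\
  fexpect mu (fun x => if `[< P x >] then g x else +oo)%E = fexpect mu g.
Proof.
move=> mu0 g0; elim: mu mu0 => [_ _|p mu IH /= /andP[p0 mu0]].
  by split=> //; rewrite !fexpect_nil.
rewrite !fexpect_cons => lty.
set h := (fun x => if `[< P x >] then g x else +oo)%E in IH lty *.
have h0 x : (0 <= h x)%E by rewrite /h; case: ifP.
have ph0 : (0 <= p.1%:E * h p.2)%E by rewrite mule_ge0.
have E0 : (0 <= fexpect mu h)%E by apply: fexpect_ge0.
have [mu_lty p_lty] : (fexpect mu h < +oo)%E /\ (p.1%:E * h p.2 < +oo)%E.
  by split; apply: le_lt_trans lty; rewrite ?leeDr ?leeDl.
have [as_mu Emu] := IH mu0 mu_lty.
rewrite Emu; have [p10|p1n0] := eqVneq p.1 0.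
  by rewrite p10 !mul0e.
have Pp : P p.2.
  apply: contrapT => nP; move: p_lty; rewrite /h asboolF// gt0_muley ?ltxx//.
  by rewrite lte_fin lt_neqAle eq_sym p1n0.
by rewrite /h asboolT.
Qed.

Lemma fexpect_cst (T : Type) (mu : fdist R T) (c : R) :
  fexpect mu (fun=> c%:E) = ((\sum_(p <- mu) p.1) * c)%:E.
Proof.
rewrite /fexpect mulr_suml -sumEFin; apply: eq_bigr => p _.
by rewrite EFinM.
Qed.

Lemma fexpectD (T : Type) mu (f g : T -> R) :
  (fexpect mu (fun x => (f x + g x)%:E) =
   fexpect mu (fun x => (f x)%:E) + fexpect mu (fun x => (g x)%:E))%E.
Proof.
rewrite /fexpect -big_split; apply: eq_bigr => p _ /=.
by rewrite -!EFinM -EFinD mulrDr.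
Qed.

Lemma fexpectMr (T : Type) mu (f : T -> R) (c : R) :
  (fexpect mu (fun x => (f x * c)%:E) = fexpect mu (fun x => (f x)%:E) * c%:E)%E.
Proof.
rewrite /fexpect (eq_bigr (fun p => (p.1 * f p.2 * c)%:E)); last first.
  by move=> p _; rewrite -EFinM mulrA.
by rewrite sumEFin -mulr_suml EFinM -sumEFin; congr (_ * _)%E.
Qed.

Lemma fexpect_fprob (T : Type) (mu : fdist R T) (E : pred T) :
  fexpect mu (fun x => ((E x)%:R)%:E) = (fprob mu E)%:E.
Proof.
rewrite /fprob [X in X%:E]big_mkcond -sumEFin; apply: eq_bigr => p _ /=.
by case: (E p.2); rewrite -EFinM ?mulr1 ?mulr0.
Qed.

Lemma le_fprob (T : Type) (mu : fdist R T) (E F : pred T) :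
  nonneg_weights mu -> (forall x, E x -> F x) -> fprob mu E <= fprob mu F.
Proof.
move=> mu0 EF; rewrite -lee_fin -!fexpect_fprob le_fexpect//.
apply: almost_surelyT => x; rewrite lee_fin ler_nat.
by have := EF x; case: (E x) => //= ->.
Qed.

Lemma fprob_predU (T : Type) (mu : fdist R T) (E F : pred T) :
  nonneg_weights mu -> fprob mu (fun x => E x || F x) <= fprob mu E + fprob mu F.
Proof.
move=> mu0; rewrite -lee_fin EFinD -!fexpect_fprob -fexpectD le_fexpect//.
apply: almost_surelyT => x; rewrite lee_fin -natrD ler_nat.
by case: (E x); case: (F x).
Qed.

Lemma fprob_ge0 (T : Type) (mu : fdist R T) (E : pred T) :
  nonneg_weights mu -> 0 <= fprob mu E.
Proof.
by move=> mu0; rewrite -lee_fin -fexpect_fprob fexpect_ge0// => x.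
Qed.

Lemma fprob_le_weight (T : Type) (mu : fdist R T) (E : pred T) :
  nonneg_weights mu -> fprob mu E <= \sum_(p <- mu) p.1.
Proof.
move=> mu0; rewrite -lee_fin -fexpect_fprob -[X in (_ <= X%:E)%E]mulr1 -fexpect_cst.
by rewrite le_fexpect//; apply: almost_surelyT => x; rewrite lee_fin; case: (E x).
Qed.

Lemma fprob_fmap (T U : Type) (h : T -> U) (mu : fdist R T) (E : pred U) :
  fprob (Defs.fmap h mu) E = fprob mu (fun x => E (h x)).
Proof. by rewrite /fprob big_map. Qed.

End FiniteDistributionTheory.

(** * Expected final values and deterministic execution *)

Section ExpectedFinalValue.
Variables (R : realType) (sub : cmd).
Implicit Types (s : config R) (f : config R -> \bar R).

(** [run] extends an execution at its end; [ev] peels off the first step instead, so that a program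
    can be evaluated command by command under any stack and any remaining budget. *)
Fixpoint ev (T : nat) f s : \bar R :=
  if T is T'.+1 then fexpect (Defs.step sub s) (ev T' f) else f s.

Lemma nonneg_weights_step s : nonneg_weights (Defs.step sub s).
Proof.
case: s => -[|[[|a i j e|a i j e|c1 c2|b c1 c2|b c1|a r|sz rm rs ans]|a m0] k] m;
  rewrite /nonneg_weights //= ?ler01 ?andbT//.
rewrite subr_ge0 /clamp; apply/andP; split.
  by rewrite le_max lexx.
by rewrite ge_max ler01 ge_min lexx.
Qed.

Lemma ev_cst T (c : R) s : ev T (fun=> c%:E) s = c%:E.
Proof.
elim: T s => //= T IH s.
have -> : ev T (fun=> c%:E) = fun=> c%:E by apply/funext.
rewrite fexpect_cst; suff -> : \sum_(p <- Defs.step sub s) p.1 = 1 by rewrite mul1r.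
case: s => -[|[[|a i j e|a i j e|c1 c2|b c1 c2|b c1|a r|sz rm rs ans]|a m0] k] m;
  rewrite /= /fret ?big_seq1//.
by rewrite big_cons big_seq1 /= addrC subrK.
Qed.

Lemma ev_halted T f m : ev T f ([::], m) = f ([::], m).
Proof. by elim: T => //= T IH; rewrite fexpect_fret. Qed.

Lemma ev_last T f s : ev T.+1 f s = ev T (fun s => fexpect (Defs.step sub s) f) s.
Proof.
elim: T s => // T IH s.
rewrite -[LHS]/(fexpect (Defs.step sub s) (ev T.+1 f)).
by congr fexpect; apply/funext => s'; rewrite IH.
Qed.

Lemma nonneg_weights_run c (m : store R) t : nonneg_weights (run sub c m t).
Proof.
rewrite /run; elim: t => [|t IH] /=; first by rewrite /nonneg_weights /= ler01.
by apply: nonneg_weights_fbind => // s; apply: nonneg_weights_step.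
Qed.

Lemma fexpect_run c m t f : (forall s, 0 <= f s)%E ->
  fexpect (run sub c m t) f = ev t f ([:: Do R c], m).
Proof.
elim: t f => [|t IH] f f0; first by rewrite fexpect_fret.
rewrite ev_last -IH; last first.
  by move=> s; rewrite fexpect_ge0// nonneg_weights_step.
rewrite /run iterS fexpect_fbind//; first exact: nonneg_weights_run.
by move=> x; apply: nonneg_weights_step.
Qed.

Lemma weight_run c (m : store R) t : \sum_(p <- run sub c m t) p.1 = 1.
Proof.
apply/EFin_inj; rewrite -[in LHS](mulr1 (\sum_(p <- _) _)) -fexpect_cst.
by rewrite fexpect_run ?ev_cst// => s; rewrite lee01.
Qed.

(* A subroutine is run step by step on top of the frames [k] of its callers,
   so a bound [g] on what follows its return may be averaged over its outcomes,
   although these need not return at the same time. *)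
Lemma ev_stack_cat f (k st : seq (frame R)) m (g : store R -> \bar R) t T0 T :
  (forall s, 0 <= f s)%E ->
  (forall m', (0 <= g m')%E) ->
  (forall m' T', (T0 <= T')%N -> (ev T' f (k, m') <= g m')%E) ->
  (t + T0 <= T)%N ->
  (ev T f (st ++ k, m) <=
   ev t (fun s => if `[< s.1 = [::] >] then g s.2 else +oo) (st, m))%E.
Proof.
move=> f0 g0 fg; elim: t T st m => [|t IH] T st m tT.
  (* With no budget left, pending frames make the right-hand side [+oo]. *)
  rewrite /=; case: st => [|fr st] /=; last by rewrite asboolF// leey.
  by rewrite asboolT// fg.
case: st => [|fr st].
  rewrite ev_halted /= asboolT// fg//; apply: leq_trans tT.
  exact: leq_addl.
case: T tT => // T; rewrite addSn ltnS => tT.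
rewrite [ev T.+1]/= [ev t.+1]/=.
(* A nonempty stack is stepped by its top frame alone, so the frames [k] below it are carried along
   unchanged. *)
have [l El] : exists l, Defs.step sub (fr :: st, m) = l /\
    Defs.step sub ((fr :: st) ++ k, m) = [seq (p.1, (p.2.1 ++ k, p.2.2)) | p <- l].
  exists (Defs.step sub (fr :: st, m)); split=> //.
  by case: fr => [[]|] //= *; case: ifP.
have nl : nonneg_weights l by rewrite -El.1 nonneg_weights_step.
rewrite El.1 El.2 -[map _ _]/(Defs.fmap (fun s => (s.1 ++ k, s.2)) l).
rewrite fexpect_fmap; apply: le_fexpect => //; apply: almost_surelyT.
by move=> [st' m'] /=; apply: IH.
Qed.

End ExpectedFinalValue.

Section DeterministicExecution.
Variable R : realType.
Implicit Types (m : store R) (c : cmd).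

(** Without rules for [Coin] and [Call] the relation is deterministic; its step counts are exact, so
    that [exec_ev] is an equation for every remaining budget. *)
Inductive exec : cmd -> store R -> store R -> nat -> Prop :=
| exec_skip m : exec Skip m m 1
| exec_nset a i j e m :
    exec (NSet a i j e) m (nset m a (neval m i) (neval m j) (neval m e)) 1
| exec_rset a i j e m :
    exec (RSet a i j e) m (rset m a (neval m i) (neval m j) (reval m e)) 1
| exec_seq c1 c2 m m1 m2 t1 t2 :
    exec c1 m m1 t1 -> exec c2 m1 m2 t2 -> exec (Seq c1 c2) m m2 (t1 + t2).+1
| exec_if b c1 c2 m m' t :
    exec (if beval m b then c1 else c2) m m' t -> exec (If b c1 c2) m m' t.+1
| exec_while_false b c m : ~~ beval m b -> exec (While b c) m m 1
| exec_while_true b c m m1 m2 t1 t2 :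
    beval m b -> exec c m m1 t1 -> exec (While b c) m1 m2 t2 ->
    exec (While b c) m m2 (t1 + t2).+1.

Lemma exec_ev sub c m m' t : exec c m m' t ->
  forall (k : seq (frame R)) T f,
    ev sub (t + T) f (Do R c :: k, m) = ev sub T f (k, m').
Proof.
elim=> {c m m' t} [m|a i j e m|a i j e m|c1 c2 m m1 m2 t1 t2 _ IH1 _ IH2
  |b c1 c2 m m' t _ IH|b c m /negbTE bF|b c m m1 m2 t1 t2 bT _ IH1 _ IH2] k T f.
- by rewrite /= fexpect_fret.
- by rewrite /= fexpect_fret.
- by rewrite /= fexpect_fret.
- by rewrite addSn -addnA /= fexpect_fret IH1 IH2.
- by rewrite addSn /= fexpect_fret IH.
- by rewrite /= fexpect_fret bF.
- by rewrite addSn -addnA /= fexpect_fret bT IH1 IH2.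
Qed.

Fixpoint nwrites c : seq nat :=
  match c with
  | NSet a _ _ _ | Coin a _ | Call _ _ _ a => [:: a]
  | Seq c1 c2 | If _ c1 c2 => nwrites c1 ++ nwrites c2
  | While _ c1 => nwrites c1
  | _ => [::]
  end.

Fixpoint rwrites c : seq nat :=
  match c with
  | RSet a _ _ _ => [:: a]
  | Seq c1 c2 | If _ c1 c2 => rwrites c1 ++ rwrites c2
  | While _ c1 => rwrites c1
  | _ => [::]
  end.

Definition agree_off c m m' : Prop :=
  (forall a, a \notin nwrites c -> narr m' a = narr m a) /\
  (forall a, a \notin rwrites c -> rarr m' a = rarr m a).

Lemma updC (X : Type) (h : nat -> nat -> nat -> X) a i j x a' :
  a' != a -> upd h a i j x a' = h a'.
Proof. by move=> /negbTE a'a; apply/funext => i'; apply/funext => j'; rewrite /upd a'a. Qed.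

Lemma exec_agree_off c m m' t : exec c m m' t -> agree_off c m m'.
Proof.
rewrite /agree_off.
elim=> {c m m' t} [m|a i j e m|a i j e m|c1 c2 m m1 m2 t1 t2 _ [N1 R1] _ [N2 R2]
  |b c1 c2 m m' t _|b c m _|b c m m1 m2 t1 t2 _ _ [N1 R1] _ [N2 R2]] //=.
- by split=> a' //; rewrite inE => ha; rewrite updC.
- by split=> a' //; rewrite inE => ha; rewrite updC.
- by split=> a; rewrite mem_cat negb_or => /andP[? ?]; rewrite ?N2 ?N1 ?R2 ?R1.
- by case: ifP => _ [N R']; split=> a; rewrite mem_cat negb_or => /andP[? ?];
    rewrite ?N ?R'.
- by split=> a ha; rewrite ?N2 ?N1 ?R2 ?R1.
Qed.

Definition wp c (t : nat) (S : store R -> Prop) m : Prop :=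
  exists m' t', [/\ exec c m m' t', (t' <= t)%N & S m'].

(** The frame condition comes for free with the postcondition, so invariants need not mention the
    arrays that a command never writes. *)
Lemma wp_conseq c t t' (S S' : store R -> Prop) m :
  wp c t S m -> (t <= t')%N ->
  (forall m', agree_off c m m' -> S m' -> S' m') -> wp c t' S' m.
Proof.
move=> [m' [u [cm ut Sm]]] tt' SS'; exists m', u; split=> //.
  exact: leq_trans tt'.
by apply: SS' Sm; apply: exec_agree_off cm.
Qed.

Lemma wp_seq c1 c2 t1 t2 (S : store R -> Prop) m :
  wp c1 t1 (wp c2 t2 S) m -> wp (Seq c1 c2) (t1 + t2).+1 S m.
Proof.
move=> [m1 [u1 [c1m u1t [m2 [u2 [c2m u2t Sm]]]]]].
exists m2, (u1 + u2).+1; split=> //; first exact: exec_seq c2m.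
by rewrite ltnS leq_add.
Qed.

Fixpoint straight_line c : bool :=
  match c with
  | Skip | NSet _ _ _ _ | RSet _ _ _ _ => true
  | Seq c1 c2 | If _ c1 c2 => straight_line c1 && straight_line c2
  | _ => false
  end.

Fixpoint cmd_size c : nat :=
  match c with
  | Seq c1 c2 | If _ c1 c2 => (cmd_size c1 + cmd_size c2).+1
  | _ => 1
  end.

Fixpoint effect c m : store R :=
  match c with
  | NSet a i j e => nset m a (neval m i) (neval m j) (neval m e)
  | RSet a i j e => rset m a (neval m i) (neval m j) (reval m e)
  | Seq c1 c2 => effect c2 (effect c1 m)
  | If b c1 c2 => if beval m b then effect c1 m else effect c2 m
  | _ => m
  end.

Lemma wp_straight_line c (S : store R -> Prop) m :
  straight_line c -> S (effect c m) -> wp c (cmd_size c) S m.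
Proof.
move=> lc Sm; suff [u ut cm] : exists2 u, (u <= cmd_size c)%N & exec c m (effect c m) u.
  by exists (effect c m), u.
elim: c m lc {Sm} => //=.
- by move=> m _; exists 1%N => //; apply: exec_skip.
- by move=> a i j e m _; exists 1%N => //; apply: exec_nset.
- by move=> a i j e m _; exists 1%N => //; apply: exec_rset.
- move=> c1 IH1 c2 IH2 m /andP[/(IH1 m)[u1 u1t e1] /(IH2 (effect c1 m))[u2 u2t e2]].
  by exists (u1 + u2).+1; [rewrite ltnS leq_add|apply: exec_seq e2].
- move=> b c1 IH1 c2 IH2 m /andP[/(IH1 m)[u1 u1t e1] /(IH2 m)[u2 u2t e2]].
  case: ifP => bm; [exists u1.+1|exists u2.+1];
    rewrite ?ltnS; try by apply: exec_if; rewrite bm.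
    exact: leq_trans u1t (leq_addr _ _).
  exact: leq_trans u2t (leq_addl _ _).
Qed.

End DeterministicExecution.

Definition nvar (a : nat) : nexp := NGet a (NConst 0) (NConst 0).

(* The array 0 of naturals holds the number of vertices. *)
Definition loop (v : nat) (c : cmd) : cmd :=
  Seq (NSet v (NConst 0) (NConst 0) (NConst 0))
    (While (NLe (NAdd (nvar v) (NConst 1)) (nvar 0))
      (Seq c (NSet v (NConst 0) (NConst 0) (NAdd (nvar v) (NConst 1))))).

Definition loop_time (t n : nat) : nat := (n * (t + 3) + 3)%N.

Section Loops.
Variable R : realType.
Implicit Types (m : store R) (c : cmd).

Lemma agree_off_trans c m1 m2 m3 :
  agree_off c m1 m2 -> agree_off c m2 m3 -> agree_off c m1 m3.
Proof.
by move=> [N1 R1] [N2 R2]; split=> a ha; rewrite ?N2 ?N1 ?R2 ?R1.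
Qed.

Lemma agree_off_sub c c' m m' :
  {subset nwrites c <= nwrites c'} -> {subset rwrites c <= rwrites c'} ->
  agree_off c m m' -> agree_off c' m m'.
Proof.
move=> Nc Rc [N1 R1]; split=> a ha; rewrite ?N1 ?R1//.
  by apply: contra ha => /Nc.
by apply: contra ha => /Rc.
Qed.

Lemma agree_off_nset c a i j k m : a \in nwrites c -> agree_off c m (nset m a i j k).
Proof.
move=> ac; split=> // a' ha'; rewrite /= updC//.
by apply: contra ha' => /eqP->.
Qed.

Lemma mem_nwrites_loop v c a :
  (a \in nwrites (loop v c)) = (a == v) || (a \in nwrites c).
Proof. by rewrite /= inE mem_cat inE; case: (a == v); rewrite ?orbF. Qed.

Lemma mem_rwrites_loop v c a : (a \in rwrites (loop v c)) = (a \in rwrites c).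
Proof. by rewrite /= mem_cat orbF. Qed.

(** The body may assume the frame condition relative to the store at loop entry, so [I] only has to
    describe what the loop changes. *)
Lemma wp_loop v c n t (I : nat -> store R -> Prop) m0 :
  v != 0%N -> v \notin nwrites c -> 0%N \notin nwrites c ->
  (forall i m k, I i m -> I i (nset m v 0 0 k)) ->
  narr m0 0 0 0 = n -> I 0%N m0 ->
  (forall i m, (i < n)%N -> agree_off (loop v c) m0 m -> narr m v 0 0 = i ->
     I i m -> wp c t (I i.+1) m) ->
  wp (loop v c) (loop_time t n) (I n) m0.
Proof.
move=> v0 vc c0 Iset n0 I0 body.
have vl : v \in nwrites (loop v c) by rewrite mem_nwrites_loop eqxx.
have cl : {subset nwrites c <= nwrites (loop v c)} /\
          {subset rwrites c <= rwrites (loop v c)}.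
  by split=> a ac; rewrite ?mem_nwrites_loop ?mem_rwrites_loop ac ?orbT.
have nl : 0%N \notin nwrites (loop v c).
  by rewrite mem_nwrites_loop eq_sym (negbTE v0).
suff H : forall d i m, (d + i)%N = n -> agree_off (loop v c) m0 m ->
    narr m v 0 0 = i -> I i m ->
    exists m' t', [/\ exec (While (NLe (NAdd (nvar v) (NConst 1)) (nvar 0))
      (Seq c (NSet v (NConst 0) (NConst 0) (NAdd (nvar v) (NConst 1))))) m m' t',
        (t' <= d * (t + 3) + 1)%N & I n m'].
  have [||//|m' [t' [E le Im]]] := H n 0%N (nset m0 v 0 0 0) (addn0 n).
  - exact: agree_off_nset.
  - by rewrite /= /upd !eqxx.
  - exact: Iset.
  exists m', (1 + t').+1; split=> //; last by rewrite /loop_time; lia.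
  by apply: exec_seq E; apply: exec_nset.
have guard m : agree_off (loop v c) m0 m ->
    beval m (NLe (NAdd (nvar v) (NConst 1)) (nvar 0)) = (narr m v 0 0 < n)%N.
  by move=> [N _]; rewrite /= (N 0%N)// n0 addn1.
elim=> [|d IH] i m din A mv Im.
  exists m, 1%N; split=> //; last by rewrite -din.
  by apply: exec_while_false; rewrite guard// mv -din ltnn.
have [|m1 [t1 [E1 le1 I1]]] := body i m _ A mv Im; first by rewrite -din; lia.
have A1 : agree_off c m m1 := exec_agree_off E1.
have m1v : narr m1 v 0 0 = i by rewrite A1.1.
set m2 := nset m1 v 0 0 (narr m1 v 0 0 + 1).
have [||||m3 [t3 [E3 le3 I3]]] := IH i.+1 m2.
- by rewrite addnS -din addSn.
- apply: agree_off_trans A _; apply: agree_off_trans (agree_off_nset _ _ _ _ vl).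
  by case: cl => ? ?; apply: agree_off_sub A1.
- by rewrite /= /upd !eqxx m1v addn1.
- exact: Iset.
exists m3, ((t1 + 1).+1 + t3).+1; split=> //; last by lia.
apply: exec_while_true E3; first by rewrite guard// mv -din addSn ltnS leq_addl.
by apply: exec_seq E1 _; apply: exec_nset.
Qed.

(** [I] holds throughout, while [Q i j] is established by the iteration at [i], [j] and preserved by
    all the others. *)
Lemma wp_loop2 v1 v2 c n t (I : store R -> Prop) (Q : nat -> nat -> store R -> Prop) m0 :
  v1 != 0%N -> v2 != 0%N -> v1 != v2 ->
  v1 \notin nwrites c -> v2 \notin nwrites c -> 0%N \notin nwrites c ->
  (forall v k m, v \in [:: v1; v2] -> I m -> I (nset m v 0 0 k)) ->
  (forall v k m i j, v \in [:: v1; v2] -> Q i j m -> Q i j (nset m v 0 0 k)) ->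
  narr m0 0 0 0 = n -> I m0 ->
  (forall i j m, (i < n)%N -> (j < n)%N -> agree_off (loop v1 (loop v2 c)) m0 m ->
     narr m v1 0 0 = i -> narr m v2 0 0 = j -> I m ->
     wp c t (fun m' => [/\ I m', Q i j m' &
                          forall i' j', Q i' j' m -> Q i' j' m']) m) ->
  wp (loop v1 (loop v2 c)) (loop_time (loop_time t n) n)
    (fun m => I m /\ forall i j, (i < n)%N -> (j < n)%N -> Q i j m) m0.
Proof.
move=> v10 v20 v12 v1c v2c c0 Iset Qset n0 I0 body.
pose J i m := I m /\ forall i' j', (i' < i)%N -> (j' < n)%N -> Q i' j' m.
have inn : v1 \in [:: v1; v2] /\ v2 \in [:: v1; v2] by rewrite !inE !eqxx orbT.
apply: (@wp_loop v1 (loop v2 c) n (loop_time t n) J) => //.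
- by rewrite mem_nwrites_loop (negbTE v12).
- by rewrite mem_nwrites_loop eq_sym (negbTE v20).
- by move=> i m k [Im Qm]; split=> [|*];
    [apply: Iset => //; case: inn|apply: Qset; [case: inn|apply: Qm]].
move=> i m ltin A mv1 [Im Qm].
have n1 : narr m 0 0 0 = n.
  by rewrite A.1// !mem_nwrites_loop !(eq_sym 0%N) (negbTE v10) (negbTE v20).
pose K j m' := [/\ I m', forall j', (j' < j)%N -> Q i j' m' &
  forall i' j', Q i' j' m -> Q i' j' m'].
apply: (@wp_conseq _ _ (loop_time t n) _ (K n)) => //.
  apply: wp_loop => //.
  - move=> j m' k [? Qi Qp]; split=> [|*|*]; first by apply: Iset => //; case: inn.
      by apply: Qset; [case: inn|apply: Qi].
    by apply: Qset; [case: inn|apply: Qp].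
  move=> j m' ltjn A' mv2 [Im' Qi Qp].
  have v1l : v1 \notin nwrites (loop v2 c).
    by rewrite mem_nwrites_loop (negbTE v12).
  have A'' : agree_off (loop v1 (loop v2 c)) m0 m'.
    apply: agree_off_trans A _; apply: agree_off_sub A' => a.
      by move=> ac; rewrite mem_nwrites_loop ac orbT.
    by rewrite !mem_rwrites_loop.
  apply: wp_conseq (body i j m' ltin ltjn A'' _ mv2 Im') (leqnn _) _.
    by rewrite A'.1.
  move=> m'' _ [Im'' Qij Qk]; split=> // [j'|i' j' /Qp/Qk //].
  by rewrite ltnS leq_eqVlt => /orP[/eqP->//|/Qi/Qk].
move=> m' _ [Im' Qi Qp]; split=> // i' j'.
by rewrite ltnS leq_eqVlt => /orP[/eqP->|*]; [apply: Qi|apply/Qp/Qm].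
Qed.

End Loops.

(** * Shortest-path distances *)

Section Distances.
Variables (R : realType) (n : nat) (G : wgraph R n).
Hypothesis G_connected : connected_graph G.
Implicit Types (u v w : 'I_n) (s : seq 'I_n).

Lemma walk_len_cat (l : 'I_n -> 'I_n -> R) u s1 s2 :
  walk_len l u (s1 ++ s2) = walk_len l u s1 + walk_len l (last u s1) s2.
Proof.
by elim: s1 u => [|v s1 IH] u /=; rewrite ?add0r// IH addrA.
Qed.

Lemma walk_len_ge0 u s : path (edge G) u s -> 0 <= walk_len (len G) u s.
Proof.
elim: s u => [|v s IH] u //= /andP[uv vs].
by rewrite addr_ge0 ?IH// len_ge0.
Qed.

Lemma reverse_walk u s : path (edge G) u s ->
  exists s', [/\ path (edge G) (last u s) s', last (last u s) s' = u &
                walk_len (len G) (last u s) s' = walk_len (len G) u s].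
Proof.
elim: s u => [|v s IH] u /=; first by exists [::].
move=> /andP[uv /IH[s' [ps' ls' ws']]].
exists (rcons s' u); split.
- by rewrite rcons_path ps' ls' edge_sym.
- by rewrite last_rcons.
- by rewrite -cats1 walk_len_cat /= ls' ws' addr0 addrC [in LHS]len_sym// edge_sym.
Qed.

Lemma uniq_subwalk u s : path (edge G) u s ->
  exists s', [/\ path (edge G) u s', last u s' = last u s, uniq (u :: s') &
                walk_len (len G) u s' <= walk_len (len G) u s].
Proof.
elim: s u => [|v s IH] u; first by exists [::].
move=> /andP[uv /IH[s' [ps' ls' us' ws']]].
have l0 : 0 <= len G u v by apply: len_ge0.
have [uv_eq|u_neq_v] := eqVneq u v.
  subst v; exists s'; split=> //=.
  by rewrite (le_trans ws')// lerDr.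
have [us|us] := boolP (u \in s'); last first.
  exists (v :: s'); split => //=; first by rewrite uv.
    by rewrite inE (negbTE u_neq_v) us.
  by rewrite lerD2l.
case/splitPr: us ps' ls' us' ws' => p1 p2.
rewrite cat_path last_cat walk_len_cat /= mem_cat cat_uniq /=.
move=> /and3P[pp1 p1u pp2] lp2 /andP[_ /and3P[_ _ up2]] wp2.
exists p2; split=> //.
have w1 := walk_len_ge0 pp1; have l1 := len_ge0 p1u.
by rewrite (le_trans _ (lerD l0 wp2))// add0r; lra.
Qed.

(** The infimum is attained: every walk dominates a duplicate-free one, and those have fewer than
    [n] steps, hence range over a finite type. *)
Lemma shortest_walk u v :
  exists s, [/\ path (edge G) u s, last u s = v, (size s < n)%N &
    forall s', path (edge G) u s' -> last u s' = v ->
      walk_len (len G) u s <= walk_len (len G) u s'].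
Proof.
pose P (b : n.-bseq 'I_n) := [&& path (edge G) u b, last u b == v & uniq (u :: b)].
have small s : uniq (u :: s) -> (size s < n)%N.
  move=> us; have := max_card [in u :: s].
  by rewrite card_ord (card_uniqP us).
have ub s : path (edge G) u s -> last u s = v ->
    exists2 b, P b & walk_len (len G) u b <= walk_len (len G) u s.
  move=> /uniq_subwalk[s' [ps' ls' us' ws']] lsv.
  exists (insub_bseq n s'); rewrite /P /insub_bseq insubdK ?unfold_in ?(ltnW (small _ us'))//.
  by rewrite ps' ls' lsv eqxx.
have /connectP[s0 ps0 ls0] := G_connected u v.
have [b0 Pb0 _] := ub s0 ps0 (esym ls0).
case: (Order.TotalTheory.arg_minP (fun b : n.-bseq 'I_n => walk_len (len G) u b) Pb0)
  => b /and3P[pb lb ub'] bmin.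
exists b; split=> //; first exact/eqP.
  exact: small.
by move=> s' /ub ubs /ubs[b' /bmin + b's]; move=> /le_trans; apply.
Qed.

Lemma spdist_gdist u v : exists s,
  [/\ path (edge G) u s, last u s = v, (size s < n)%N,
      walk_len (len G) u s = gdist G u v & spdist (edge G) (len G) u v = (gdist G u v)%:E].
Proof.
have [s [ps ls szs smin]] := shortest_walk u v.
have E : spdist (edge G) (len G) u v = (walk_len (len G) u s)%:E.
  apply/eqP; rewrite eq_le; apply/andP; split.
    by apply: ereal_inf_lbound; exists s.
  apply: le_ereal_inf_tmp => _ [s' [ps' ls'] <-].
  by rewrite lee_fin smin.
by exists s; split=> //; rewrite /gdist E.
Qed.

Lemma gdist_walk u v : exists s,
  [/\ path (edge G) u s, last u s = v, (size s < n)%N &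
      walk_len (len G) u s = gdist G u v].
Proof. by have [s [*]] := spdist_gdist u v; exists s. Qed.

Lemma gdist_le_walk u s : path (edge G) u s ->
  gdist G u (last u s) <= walk_len (len G) u s.
Proof.
move=> ps; have [_ [_ _ _ _ E]] := spdist_gdist u (last u s).
by rewrite -lee_fin -E; apply: ereal_inf_lbound; exists s.
Qed.

Lemma gdist_ge0 u v : 0 <= gdist G u v.
Proof. by have [s [ps _ _ <-]] := gdist_walk u v; apply: walk_len_ge0. Qed.

Lemma gdistxx u : gdist G u u = 0.
Proof.
by apply/eqP; rewrite eq_le gdist_ge0 andbT (@gdist_le_walk u [::]).
Qed.

Lemma gdist_le_len u v : edge G u v -> gdist G u v <= len G u v.
Proof.
by move=> uv; have := @gdist_le_walk u [:: v]; rewrite /= uv addr0; apply.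
Qed.

Lemma gdist_sym u v : gdist G u v = gdist G v u.
Proof.
wlog suff : u v / gdist G u v <= gdist G v u.
  by move=> H; apply/eqP; rewrite eq_le !H.
have [s [ps <- _ <-]] := gdist_walk v u.
have [s' [ps' ls' <-]] := reverse_walk ps.
by have := gdist_le_walk ps'; rewrite ls'.
Qed.

Lemma gdist_triangle v u w : gdist G u w <= gdist G u v + gdist G v w.
Proof.
have [s1 [p1 l1 _ <-]] := gdist_walk u v.
have [s2 [p2 l2 _ <-]] := gdist_walk v w.
have := @gdist_le_walk u (s1 ++ s2).
by rewrite cat_path last_cat walk_len_cat l1 l2 p1 p2; apply.
Qed.

End Distances.

(** * The supermartingale *)

Section ScalarBounds.
Variables (R : realType) (b l A : R).
Hypotheses (b1 : 1 <= b) (l0 : 0 <= l) (A0 : 0 <= A).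

(* For an edge of length [l] at distance [A] from the terminals, cut with
   probability at most [b * l / rp]: [half_cost] is paid when one end is assigned,
   [free_cost] when none is, and [level_count] bounds the number of scales that can
   still separate the ends.  If [A = 0] and [r = 0] the latter is [0], by [0 / 0 = 0]. *)
Definition half_cost (r : R) : R := Num.max (4 * r) (8 * (b * l)) + 8 * (b * l).

Definition level_count (r : R) : R :=
  ln (Num.max 1 (2 * b * A / Num.max r (A / 4))) / ln 2.

Definition free_cost (r : R) : R := 23 * (b * l) * (2 + level_count r).

Lemma half_cost_ge r : 4 * r + 8 * (b * l) <= half_cost r.
Proof. by rewrite lerD2r le_max lexx. Qed.

Lemma half_cost_le r : 0 <= r -> half_cost r <= 4 * r + 16 * (b * l).
Proof.
have b1_ := b1; have l0_ := l0.
move=> r0; have bl0 : 0 <= b * l by rewrite mulr_ge0// (le_trans ler01).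
have : Num.max (4 * r) (8 * (b * l)) <= 4 * r + 8 * (b * l).
  by rewrite ge_max; apply/andP; split; lra.
by rewrite /half_cost; lra.
Qed.

(** For [rp] up to [2 * (b * l)] both sides sit at the plateau [16 * (b * l)], and the left one is a
    convex combination below it. Beyond, [s] is less than one half, so [s * (4 * rp)] and
    [s * (8 * (b * l))] contribute at most [4 * (b * l)] each. *)
Lemma half_cost_step r rp s :
  0 <= r -> 2 * r <= rp -> 0 <= s <= 1 -> s * rp <= b * l ->
  4 * r + s * (half_cost rp - 4 * r) <= half_cost r.
Proof.
have b1_ := b1; have l0_ := l0.
move=> r0 rrp /andP[s0 s1] srp.
have bl0 : 0 <= b * l by rewrite mulr_ge0// (le_trans ler01).
have [small|big] := leP rp (2 * (b * l)).
  have -> : half_cost rp = 16 * (b * l) by rewrite /half_cost max_r; lra.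
  have -> : half_cost r = 16 * (b * l) by rewrite /half_cost max_r; lra.
  have : 0 <= (1 - s) * (16 * (b * l) - 4 * r) by apply: mulr_ge0; lra.
  lra.
have -> : half_cost rp = 4 * rp + 8 * (b * l) by rewrite /half_cost max_l//; lra.
apply: le_trans (half_cost_ge r).
have : s * (2 * (b * l)) <= s * rp by rewrite ler_wpM2l// ltW.
have : 0 <= s * r by rewrite mulr_ge0.
lra.
Qed.

(** The constant is 6 + 17: [4 * r] and [half_cost rp] contain at most [6 * rp], of which [s] leaves
    [6 * (b * l)], and the rest is at most [(1 + 16) * (b * l)]. *)
Lemma cut_cost_le r rp s :
  0 <= r -> 2 * r <= rp -> 0 <= s <= 1 -> s * rp <= b * l ->
  s * (4 * r + l + half_cost rp) <= 23 * (b * l).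
Proof.
have b1_ := b1; have l0_ := l0.
move=> r0 rrp /andP[s0 s1] srp.
have bl : l <= b * l by rewrite ler_peMl.
have H : half_cost rp <= 4 * rp + 16 * (b * l) by apply: half_cost_le; lra.
have : s * (4 * r + l + half_cost rp) <= s * (6 * rp + 17 * (b * l)).
  by rewrite ler_wpM2l//; lra.
have bl0 : 0 <= b * l by apply: le_trans l0 bl.
have : s * (b * l) <= b * l by rewrite ler_piMl.
by lra.
Qed.

Lemma ln2_gt0 : 0 < ln (2 : R).
Proof. by rewrite ln_gt0// ltr1n. Qed.

Lemma level_count_ge0 r : 0 <= level_count r.
Proof. by rewrite divr_ge0 ?ln_ge0 ?le_max ?lexx ?ler1n. Qed.

(** The floor [A / 4] under the scale caps the ratio at [8 * b], however small [r] is. *)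
Lemma level_count_le r : 0 <= r -> level_count r <= ln (8 * b) / ln 2.
Proof.
have b1_ := b1; have A0_ := A0.
move=> r0; rewrite ler_pM2r ?invr_gt0 ?ln2_gt0//.
have b8 : 1 <= 8 * b by lra.
rewrite ler_ln ?posrE ?lt_max ?ltr01//; last exact: lt_le_trans b8.
rewrite ge_max b8/=.
have [A00|An0] := eqVneq A 0; first by rewrite A00 mulr0 mul0r; lra.
have Agt0 : 0 < A by rewrite lt_neqAle eq_sym An0.
have m0 : 0 < Num.max r (A / 4) by rewrite lt_max orbC divr_gt0.
rewrite ler_pdivrMr//; have : A / 4 <= Num.max r (A / 4) by rewrite le_max lexx orbT.
move=> h; have : 8 * b * (A / 4) <= 8 * b * Num.max r (A / 4).
  by rewrite ler_wpM2l//; lra.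
lra.
Qed.

Lemma level_count_decr r rp : 0 < A -> r <= rp -> level_count rp <= level_count r.
Proof.
have b1_ := b1; have A0_ := A0.
move=> Agt0 rrp; rewrite ler_pM2r ?invr_gt0 ?ln2_gt0//.
rewrite ler_ln ?posrE ?lt_max ?ltr01//.
rewrite ge_max !le_max lexx/=; apply/orP; right.
have q x : 0 < Num.max x (A / 4) by rewrite lt_max orbC divr_gt0.
rewrite ler_wpM2l ?mulr_ge0//; first lra.
by rewrite lef_pV2 ?posrE// ge_max !le_max rrp lexx orbT.
Qed.

(** Both maxima with [A / 4] are inactive here, so doubling the scale halves the ratio and lowers
    its binary logarithm by one. *)
Lemma level_count_step r rp :
  A <= 4 * r -> 2 * r <= rp -> 0 < rp -> rp < 2 * b * A ->
  1 + level_count rp <= level_count r.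
Proof.
have b1_ := b1; have A0_ := A0.
move=> Ar rrp rp0 rpA.
have Agt0 : 0 < A.
  rewrite lt_neqAle A0 andbT; apply: contraTneq rpA => <-.
  by rewrite mulr0 -leNgt ltW.
rewrite /level_count (max_l (_ : A / 4 <= rp)); last lra.
rewrite (max_l (_ : A / 4 <= r)); last lra.
have r0 : 0 < r by lra.
have q1 : 1 <= 2 * b * A / rp by rewrite ler_pdivlMr// mul1r ltW.
rewrite (max_r q1) -[X in X + _](divff (lt0r_neq0 ln2_gt0)) -mulrDl.
rewrite ler_pM2r ?invr_gt0 ?ln2_gt0// -lnM ?posrE//; last exact: lt_le_trans q1.
have b0 : 0 < b by lra.
rewrite ler_ln ?posrE ?lt_max ?ltr01 ?mulr_gt0 ?invr_gt0//.
rewrite le_max; apply/orP; right.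
rewrite mulrA ler_pdivrMr// [leRHS]mulrAC ler_pdivlMr//.
have : 2 * b * A * (2 * r) <= 2 * b * A * rp by rewrite ler_wpM2l// mulr_ge0//; lra.
lra.
Qed.

(** Here [p] bounds the probability of staying free. While [rp < 2 * b * A], one unit of
    [level_count] pays for the scale. Afterwards [p] is at most one half, and the remaining 2 in
    [free_cost] is the fixed point of [1 + c / 2 = c]. *)
Lemma free_cost_step r rp p :
  0 <= r -> A <= 4 * r -> 2 * r <= rp -> 0 < rp -> 0 <= p <= 1 -> p * rp <= b * A ->
  23 * (b * l) + p * free_cost rp <= free_cost r.
Proof.
have b1_ := b1; have l0_ := l0; have A0_ := A0.
move=> r0 Ar rrp rp0 /andP[p0 p1] prp.
have bl0 : 0 <= b * l by rewrite mulr_ge0// (le_trans ler01).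
have [big|small] := leP (2 * b * A) rp.
  have -> : free_cost rp = 46 * (b * l).
    rewrite /free_cost /level_count max_l ?ln1 ?mul0r; first by ring.
    rewrite ler_pdivrMr ?lt_max ?rp0// mul1r le_max big//.
  have p2 : p <= 1 / 2.
    by rewrite -(ler_pM2r rp0); lra.
  have : p * (46 * (b * l)) <= 1 / 2 * (46 * (b * l)) by rewrite ler_wpM2r//; lra.
  have : 46 * (b * l) <= free_cost r.
    rewrite (_ : 46 * (b * l) = 23 * (b * l) * 2); last by ring.
    by apply: ler_wpM2l; first lra; rewrite lerDl; apply: level_count_ge0.
  lra.
have f0 : 0 <= free_cost rp.
  by rewrite mulr_ge0 ?addr_ge0 ?level_count_ge0//; lra.
have : p * free_cost rp <= free_cost rp by rewrite ler_piMl.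
have := level_count_step Ar rrp rp0 small.
rewrite -(@lerD2l _ 2) => H.
have bl23 : 0 <= 23 * (b * l) by lra.
have := ler_wpM2l bl23 H.
rewrite /free_cost; lra.
Qed.

End ScalarBounds.

(** 322 is 46 times 7: [23 * (2 * beta)] gives 46, and with [log2 (16 * beta) = 4 + log2 beta] the
    count is [6 + log2 beta], at most [7 * log2 beta] as [beta >= 2]. *)
Lemma free_cost_0_le (R : realType) (beta l A : R) :
  2 <= beta -> 0 <= l -> 0 <= A ->
  free_cost (2 * beta) l A 0 <= 322 / ln 2 * (beta * ln beta) * l.
Proof.
move=> b2 l0 A0.
have L2 := @ln2_gt0 R.
have bl0 : 0 <= beta * l by rewrite mulr_ge0//; lra.
have b1 : 1 <= 2 * beta by lra.
have := @level_count_le R (2 * beta) A b1 A0 0 (lexx _).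
have -> : 8 * (2 * beta) = 2 ^+ 4 * beta by ring.
rewrite lnM ?posrE ?exprn_gt0//; last lra.
rewrite lnXn// (_ : (ln 2 *+ 4 + ln beta) / ln 2 = 4 + ln beta / ln 2) => [H|]; last first.
  by rewrite -(mulr_natl (ln 2)) mulrDl mulfK ?lt0r_neq0.
have h1 : 1 <= ln beta / ln 2.
  by rewrite ler_pdivlMr// mul1r ler_ln ?posrE//; lra.
have : 46 * (beta * l) * (2 + level_count (2 * beta) A 0)
       <= 46 * (beta * l) * (7 * (ln beta / ln 2)).
  by rewrite ler_wpM2l ?mulr_ge0//; lra.
have -> : free_cost (2 * beta) l A 0 =
    46 * (beta * l) * (2 + level_count (2 * beta) A 0).
  by rewrite /free_cost; ring.
by move=> /le_trans -> //; rewrite le_eqVlt; apply/orP; left; apply/eqP; ring.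
Qed.

(* In an assignment [f], the code [0] marks an unassigned vertex and [x.+1] a
   vertex assigned to the terminal [x]. *)
Section Assignments.
Variables (R : realType) (n : nat) (G : wgraph R n).
Hypothesis G_connected : connected_graph G.
Variable K : {set 'I_n}.
Implicit Types (u v w x y : 'I_n) (f lab : 'I_n -> nat) (r : R).

Definition branches_connected f : Prop :=
  forall u x, f u = x.+1 ->
    connect [rel a b | [&& edge G a b, f a == x.+1 & f b == x.+1]] u x.

(* [f'] extends [f] inside the clusters of [lab], each component of unassigned
   vertices in a cluster copying one assigned neighbour. *)
Record extends lab f f' : Prop := Extends {
  extends_keep : forall u, f u != 0%N -> f' u = f u;
  extends_source : forall u, f' u != 0%N ->
    exists w, [/\ f w = f' u, lab w = lab u & f w != 0%N];
  extends_closed : forall u v, edge G u v -> lab u = lab v ->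
    f' u != 0%N -> f' v != 0%N;
  extends_edge : forall u v, edge G u v -> lab u = lab v ->
    f u = 0%N -> f v = 0%N -> f' u = f' v;
  extends_connected : branches_connected f -> branches_connected f' }.

Record assignment f r : Prop := Assignment {
  assignment_terminal : forall x, x \in K -> f x = x.+1;
  assignment_dist : forall u, f u != 0%N ->
    exists x, [/\ x \in K, f u = x.+1 & gdist G u x <= 2 * r];
  assignment_connected : branches_connected f }.

(** Positivity is required separately because at the initial scale [0] the bound [2 * r] would admit
    distance zero, which distinct vertices may have. *)
Definition next_scale r rp : Prop :=
  [/\ 0 < rp, 2 * r <= rp &
      forall u v, 0 < gdist G u v -> 2 * r <= gdist G u v -> rp <= gdist G u v].

Definition last_scale r : Prop :=
  forall u v, 0 < gdist G u v -> gdist G u v < 2 * r.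

Definition diam_le lab r : Prop := forall u v, lab u = lab v -> gdist G u v <= r.

(* No distance lies in [2 r, rp), so a bound [rp / 2] improves to [2 r]. *)
Lemma next_scale_diam r rp lab : 0 <= r -> next_scale r rp ->
  diam_le lab (rp / 2) -> diam_le lab (2 * r).
Proof.
move=> r0 [rp0 rrp gap] D u v /D uv.
rewrite leNgt; apply/negP => rd.
have := gap u v (le_lt_trans _ rd) (ltW rd); rewrite mulr_ge0// => /(_ isT).
lra.
Qed.

Lemma last_scale_diam r lab : 0 <= r -> last_scale r -> diam_le lab (2 * r).
Proof.
move=> r0 last u v _; have [d0|d0] := eqVneq (gdist G u v) 0.
  by rewrite d0; lra.
by apply/ltW/last; rewrite lt_neqAle eq_sym d0 (gdist_ge0 G_connected).
Qed.

Lemma extends_dist f f' lab r u : assignment f r -> diam_le lab (2 * r) ->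
  extends lab f f' -> f' u != 0%N ->
  exists x, [/\ x \in K, f' u = x.+1 & gdist G u x <= 4 * r].
Proof.
move=> af D ff' /(extends_source ff')[w [fw labw /(assignment_dist af)[x [xK fx dx]]]].
exists x; rewrite -fw; split=> //.
have := D u w (esym labw).
by have := gdist_triangle G_connected w u x; lra.
Qed.

(** The distance to the terminal grows from [2 * r] to [4 * r] by the cluster diameter; the doubling
    of the scale restores the invariant. *)
Lemma assignment_extends f f' lab r rp : assignment f r -> diam_le lab (2 * r) ->
  2 * r <= rp -> extends lab f f' -> assignment f' rp.
Proof.
move=> af D rrp ff'; split.
- by move=> x xK; rewrite (extends_keep ff') (assignment_terminal af).
- move=> u /(extends_dist af D ff')[x [xK fx dx]].
  by exists x; split=> //; lra.
- exact: extends_connected ff' (assignment_connected af).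
Qed.

(** Being total on codes, it lets potentials be written without decoding; it vanishes on equal
    codes, also on two unassigned ones. *)
Definition code_dist (k k' : nat) : R := matr 0 (gdist G) k.-1 k'.-1.

Lemma code_distE x y : code_dist x.+1 y.+1 = gdist G x y.
Proof. by rewrite /code_dist /matr /= !valK. Qed.

Lemma code_dist_ge0 k k' : 0 <= code_dist k k'.
Proof.
by rewrite /code_dist /matr; do 2![case: insubP => [? _ _|_] //]; apply: gdist_ge0.
Qed.

Lemma code_distxx k : code_dist k k = 0.
Proof. by rewrite /code_dist /matr; case: insubP => [? _ _|_] //; apply: gdistxx. Qed.

Lemma gdist_le_edge u v x y : edge G u v ->
  gdist G x y <= gdist G u x + len G u v + gdist G v y.
Proof.
move=> uv.
have := gdist_le_len G_connected uv.
have := gdist_triangle G_connected u x y; have := gdist_triangle G_connected v u y.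
by rewrite (gdist_sym G_connected x u); lra.
Qed.

Section EdgePotential.
Variables (u v a z : 'I_n) (b : R).
Hypotheses (b1 : 1 <= b) (uv : edge G u v).
Hypotheses (auv : a \in [:: u; v]) (zK : z \in K).
Hypothesis z_nearest : forall x, x \in K ->
  gdist G a z <= gdist G u x /\ gdist G a z <= gdist G v x.

Let l := len G u v.
Let A := gdist G a z.

(* Bounds the expected distance between the terminals that the ends of the edge
   are finally assigned to, given the assignment [f] before the scale [r]. *)
Definition potential r f : R :=
  if f u == 0%N then
    if f v == 0%N then free_cost b l A r else code_dist v.+1 (f v) + l + half_cost b l r
  else if f v == 0%N then code_dist u.+1 (f u) + l + half_cost b l r
  else code_dist (f u) (f v).

Let l0 : 0 <= l. Proof. exact: len_ge0. Qed.
Let A0 : 0 <= A. Proof. exact: gdist_ge0. Qed.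
Let bl0 : 0 <= b * l. Proof. by rewrite mulr_ge0// (le_trans ler01). Qed.

Lemma half_cost_ge0 r : 0 <= r -> 0 <= half_cost b l r.
Proof.
by move=> r0; apply: le_trans (half_cost_ge _ _ _); have := bl0; lra.
Qed.

Lemma free_cost_ge0 r : 0 <= free_cost b l A r.
Proof.
have bl0_ := bl0.
by rewrite mulr_ge0 ?addr_ge0 ?level_count_ge0//; lra.
Qed.

Lemma potential_ge0 r f : 0 <= r -> 0 <= potential r f.
Proof.
move=> r0; have h := half_cost_ge0 r0; rewrite /potential.
have := code_dist_ge0; have l0_ := l0; have := free_cost_ge0.
by case: ifP => _; case: ifP => _ => f0 c0 //; apply: addr_ge0 => //; apply: addr_ge0.
Qed.

Variables (r : R) (f : 'I_n -> nat).
Hypotheses (r0 : 0 <= r) (af : assignment f r).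

(** With a single cluster no edge is cut: two free ends receive equal codes, and a free end next to
    an assigned one adds at most [4 * r + l], which the potential already covers. *)
Lemma potential_last f' : last_scale r -> extends (fun=> 0%N) f f' ->
  code_dist (f' u) (f' v) <= potential r f.
Proof.
move=> last ff'.
have D := last_scale_diam (lab := fun=> 0%N) r0 last.
have H w : f' w != 0%N -> exists x, [/\ x \in K, f' w = x.+1 & gdist G w x <= 4 * r].
  exact: extends_dist af D ff'.
have hc := half_cost_ge b l r; have bl0_ := bl0.
rewrite /potential; case: ifPn => fu; case: ifPn => fv.
- by rewrite (extends_edge ff' uv erefl (eqP fu) (eqP fv)) code_distxx free_cost_ge0.
- rewrite -(extends_keep ff' fv).
  have fv' : f' v != 0%N by rewrite (extends_keep ff').
  have fu' : f' u != 0%N by rewrite (extends_closed ff' _ _ fv')// edge_sym.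
  have [x [xK -> dx]] := H u fu'; have [y [yK -> dy]] := H v fv'.
  by rewrite !code_distE; have := gdist_le_edge x y uv; rewrite -/l; lra.
- rewrite -(extends_keep ff' fu).
  have fu' : f' u != 0%N by rewrite (extends_keep ff').
  have fv' : f' v != 0%N by rewrite (extends_closed ff' uv _ fu').
  have [x [xK -> dx]] := H u fu'; have [y [yK -> dy]] := H v fv'.
  by rewrite !code_distE; have := gdist_le_edge x y uv; rewrite -/l; lra.
- by rewrite (extends_keep ff' fu) (extends_keep ff' fv).
Qed.

Variables (rp : R) (T : Type) (mu : fdist R T) (lab : T -> 'I_n -> nat).
Hypothesis rrp : next_scale r rp.
Hypotheses (mu0 : nonneg_weights mu) (mu1 : \sum_(p <- mu) p.1 = 1).
Hypothesis sep_le : forall x y,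
  fprob mu (fun t => lab t x != lab t y) <= b * gdist G x y / rp.

Let rp0 : 0 < rp. Proof. by case: rrp. Qed.

Let s : R := fprob mu (fun t => lab t u != lab t v).

Let s01 : 0 <= s <= 1.
Proof. by rewrite fprob_ge0//= -mu1 fprob_le_weight. Qed.

Let s_le : s * rp <= b * l.
Proof.
have := sep_le u v; rewrite -/s ler_pdivlMr// => /le_trans; apply.
by rewrite ler_wpM2l ?(le_trans ler01)// gdist_le_len.
Qed.

(** A union bound over the edges of the walk. Separation of its two endpoints would not do, since a
    flood must follow a path inside the cluster. *)
Lemma fprob_cut_le x q : path (edge G) x q ->
  fprob mu (fun t => ~~ path (fun y y' => lab t y == lab t y') x q) * rp <=
  b * walk_len (len G) x q.
Proof.
elim: q x => [|y q IH] x.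
  by rewrite /= mulr0 /fprob big_pred0_eq mul0r.
move=> /andP[xy /IH yq].
have := fprob_predU (fun t => lab t x != lab t y)
  (fun t => ~~ path (fun y y' => lab t y == lab t y') y q) mu0.
rewrite -(ler_pM2r rp0) mulrDl => H.
have h1 : fprob mu (fun t => lab t x != lab t y) * rp <= b * len G x y.
  have := sep_le x y; rewrite ler_pdivlMr// => /le_trans; apply.
  by rewrite ler_wpM2l ?(le_trans ler01)// gdist_le_len.
rewrite /= mulrDr; apply: le_trans (lerD h1 yq); apply: le_trans H.
rewrite ler_wpM2r ?(ltW rp0)//; apply: le_fprob => // t.
by rewrite negb_and.
Qed.

Lemma potential_step : exists g : ('I_n -> nat) -> R,
  [/\ forall lb f', diam_le lb (2 * r) -> extends lb f f' -> potential rp f' <= g lb,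
      forall lb, 0 <= g lb &
      (fexpect mu (fun t => (g (lab t))%:E) <= (potential r f)%:E)%E].
Proof.
have r0_ := r0; have rp0_ := rp0; have bl0_ := bl0; have l0_ := l0; have A0_ := A0.
have [_ rrp2 _] := rrp.
have hrp0 : 0 <= half_cost b l rp by apply: half_cost_ge0; apply: ltW.
have hcp := half_cost_ge b l rp.
have Hd lb f' w : diam_le lb (2 * r) -> extends lb f f' -> f' w != 0%N ->
  exists x, [/\ x \in K, f' w = x.+1 & gdist G w x <= 4 * r].
  by move=> D ff'; apply: extends_dist af D ff'.
have half w w' (c : R) : (forall lb f', diam_le lb (2 * r) -> extends lb f f' ->
       potential rp f' <= c + l + (if lb w != lb w' then half_cost b l rp else 4 * r)) ->
    fprob mu (fun t => lab t w != lab t w') = s -> 0 <= c ->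
    potential r f = c + l + half_cost b l r ->
    exists g : ('I_n -> nat) -> R,
  [/\ forall lb f', diam_le lb (2 * r) -> extends lb f f' -> potential rp f' <= g lb,
      forall lb, 0 <= g lb &
      (fexpect mu (fun t => (g (lab t))%:E) <= (potential r f)%:E)%E].
  move=> Hg sE c0 ->.
  (* [w] is the assigned end and [c] its distance to its terminal. Uncut, the free end is assigned
     within [4 * r]; cut, it costs at most [half_cost] at the next scale. *)
  exists (fun lb => (c + l + 4 * r) + (lb w != lb w')%:R * (half_cost b l rp - 4 * r)).
  split.
  - move=> lb f' D ff'; apply: le_trans (Hg lb f' D ff') _.
    by case: (lb w != lb w') => /=; lra.
  - by move=> lb; case: (lb w != lb w') => /=; lra.
  - rewrite fexpectD fexpectMr fexpect_cst mu1 mul1r fexpect_fprob sE.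
    rewrite -EFinM -EFinD lee_fin.
    have := half_cost_step b1 l0 r0 rrp2 s01 s_le; lra.
case: (eqVneq (f u) 0%N) => fu; case: (eqVneq (f v) 0%N) => fv; last first.
- exists (fun=> potential r f); split.
  + move=> lb f' D ff'; rewrite /potential !(extends_keep ff')//.
    by rewrite (negbTE fu) (negbTE fv).
  + by move=> _; apply: potential_ge0.
  + by rewrite fexpect_cst mu1 mul1r.
- apply: (half u v (code_dist u.+1 (f u))); rewrite ?code_dist_ge0//; last first.
    by rewrite /potential (negbTE fu) fv.
  move=> lb f' D ff'.
  have fu' : f' u != 0%N by rewrite (extends_keep ff').
  rewrite -(extends_keep ff' fu) /potential (negbTE fu').
  case: ifPn => fv'.
    rewrite ifT//; apply/eqP => lbuv.
    by have := extends_closed ff' uv lbuv fu'; rewrite fv'.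
  have [x [xK -> dx]] := Hd _ _ _ D ff' fu'; have [y [yK -> dy]] := Hd _ _ _ D ff' fv'.
  rewrite !code_distE; have := gdist_le_edge x y uv; rewrite -/l.
  by case: ifP => _; lra.
- apply: (half v u (code_dist v.+1 (f v))); rewrite ?code_dist_ge0//; last 2 first.
  + by congr fprob; apply/funext => t; rewrite eq_sym.
  + by rewrite /potential fu (negbTE fv).
  move=> lb f' D ff'.
  have fv' : f' v != 0%N by rewrite (extends_keep ff').
  rewrite -(extends_keep ff' fv) /potential (negbTE fv').
  case: ifPn => fu'.
    rewrite ifT//; apply/eqP => lbuv; have vu : edge G v u by rewrite edge_sym.
    by have := extends_closed ff' vu lbuv fv'; rewrite fu'.
  have [x [xK -> dx]] := Hd _ _ _ D ff' fu'; have [y [yK -> dy]] := Hd _ _ _ D ff' fv'.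
  rewrite !code_distE; have := gdist_le_edge x y uv; rewrite -/l.
  by case: ifP => _; lra.
have -> : potential r f = free_cost b l A r by rewrite /potential fu fv.
(* If [4 * r < A], no terminal is within reach: both ends stay free, nothing is paid, and
   monotonicity of [level_count] suffices. *)
have [Ar|rA] := leP A (4 * r); last first.
  exists (fun=> free_cost b l A rp); split.
  + move=> lb f' D ff'.
    have un w : (forall x, x \in K -> A <= gdist G w x) -> f' w = 0%N.
      move=> wA; apply: contraTeq isT => /(Hd _ _ _ D ff')[x [xK _ dx]].
      by have := wA x xK; lra.
    by rewrite /potential !un//= => x /z_nearest[].
  + by move=> _; apply: free_cost_ge0.
  + rewrite fexpect_cst mu1 mul1r lee_fin ler_wpM2l//; first lra.
    by rewrite lerD2l (level_count_decr b1 A0)//; lra.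
have [q [pq lq _ wq]] := gdist_walk G_connected a z.
(* If the path from the end [a] to the terminal [z] is uncut, assignment propagates along it from
   [z] to [a]; so both ends can stay free only if the path is cut. *)
pose cut (lb : 'I_n -> nat) := ~~ path (fun y y' => lb y == lb y') a q.
exists (fun lb => (lb u != lb v)%:R * (4 * r + l + half_cost b l rp) +
                  (cut lb)%:R * free_cost b l A rp); split.
- move=> lb f' D ff'.
  have T0 : 0 <= free_cost b l A rp := @free_cost_ge0 rp.
  have both_free : f' u = 0%N -> f' v = 0%N -> cut lb.
    move=> fu' fv'; apply/negP => nc.
    have fa' : f' a = 0%N by move: auv; rewrite !inE => /orP[]/eqP->.
    have fz' : f' z != 0%N.
      by rewrite (extends_keep ff') (assignment_terminal af).
    suff : f' a != 0%N by rewrite fa'.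
    move: pq nc fz'; rewrite -lq; elim: (q) (a) => //= y q' IH w.
    move=> /andP[wy yq'] /andP[/eqP lwy yc] /(IH y yq' yc) fy.
    by rewrite (extends_closed ff' _ _ fy)// edge_sym.
  (* Free ends in one cluster get equal codes and cost nothing unless both stay free; only separated
     ends pay the cut cost. *)
  have [lbuv|lbuv] := eqVneq (lb u) (lb v).
    rewrite mul0r add0r.
    have E := extends_edge ff' uv lbuv fu fv.
    rewrite /potential -E; case: ifPn => [/eqP fu'|/negbTE ->].
      have fv' : f' v = 0%N by rewrite -E.
      by rewrite fu' eqxx (both_free fu' fv') mul1r.
    by rewrite code_distxx mulr_ge0.
  rewrite mul1r; have cT : 0 <= (cut lb)%:R * free_cost b l A rp by rewrite mulr_ge0.
  rewrite /potential; case: ifPn => fu'; case: ifPn => fv'.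
  + by rewrite (both_free (eqP fu') (eqP fv')) mul1r; lra.
  + have [y [yK fvy dy]] := Hd _ _ _ D ff' fv'.
    by rewrite fvy code_distE; lra.
  + have [x [xK fux dx]] := Hd _ _ _ D ff' fu'.
    by rewrite fux code_distE; lra.
  + have [x [xK -> dx]] := Hd _ _ _ D ff' fu'; have [y [yK -> dy]] := Hd _ _ _ D ff' fv'.
    by rewrite code_distE; have := gdist_le_edge x y uv; rewrite -/l; lra.
- move=> lb; have := @free_cost_ge0 rp.
  by case: (lb u != lb v); case: (cut lb) => /=; lra.
- rewrite fexpectD !fexpectMr !fexpect_fprob -!EFinM -EFinD lee_fin -/s.
  apply: le_trans (free_cost_step b1 l0 A0 r0 Ar rrp2 rp0
    (p := fprob mu (fun t => cut (lab t))) _ _).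
  + by apply: lerD => //; apply: cut_cost_le.
  + by rewrite fprob_ge0//= -mu1 fprob_le_weight.
  + by have := fprob_cut_le pq; rewrite wq.
Qed.

End EdgePotential.

End Assignments.

(** * Flooding the clusters *)

Section FloodFill.
Variables (R : realType) (n : nat) (G : wgraph R n) (L f0 : 'I_n -> nat).
Implicit Types (u v w x y : 'I_n) (f : 'I_n -> nat).

(** The flood of [w] is recognised by its code within its cluster, so no record of sources is kept:
    assigned vertices of one cluster with the same code act as one source. *)
Definition copies w u v f : bool :=
  [&& f w != 0%N, f u == f w, L u == L w, f v == 0%N, L v == L u & edge G u v].

Definition copy_step w u v f x : nat :=
  if copies w u v f && (x == v) then f w else f x.

Definition flooded w f : Prop := forall u v, ~~ copies w u v f.

Definition same_source (k : nat) f u : Prop :=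
  exists w, [/\ w = k :> nat, f u = f w & L u = L w].

Definition saturated f u : Prop :=
  forall v, edge G u v -> L u = L v -> f v != 0%N.

(* Vertices reached by the sources before [k] have no unassigned neighbour left
   in their cluster, so the fronts of two sources never meet. *)
Record flooding (k : nat) f : Prop := Flooding {
  flooding_keep : forall u, f0 u != 0%N -> f u = f0 u;
  flooding_source : forall u, f u != 0%N ->
    exists w', [/\ f0 w' = f u, L w' = L u & f0 w' != 0%N];
  flooding_connected : branches_connected G f0 -> branches_connected G f;
  flooding_edge : forall u v, edge G u v -> L u = L v -> f0 u = 0%N -> f0 v = 0%N ->
    f u != 0%N -> f v != 0%N -> f u = f v;
  flooding_front : forall u, f0 u = 0%N -> f u != 0%N ->
    same_source k f u \/ saturated f u;
  flooding_before : forall w', (w' < k)%N -> f0 w' != 0%N -> flooded w' f }.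

Section CopyStep.
Variables (w u v : 'I_n) (f : 'I_n -> nat).
Let f' := copy_step w u v f.

Lemma copy_step_keep x : f x != 0%N -> f' x = f x.
Proof.
rewrite /f' /copy_step; case: ifP => // /andP[/and5P[_ _ _ /eqP fv _] /eqP->].
by rewrite fv.
Qed.

Lemma copy_step_flooded : flooded w f -> f' = f.
Proof.
by move=> /(_ u v)/negbTE c; apply/funext => x; rewrite /f' /copy_step c.
Qed.

Lemma copy_step_copies : copies w u v f -> f' v != 0%N.
Proof. by move=> c; rewrite /f' /copy_step c eqxx; case/andP: c. Qed.

Lemma branches_connected_copy_step : branches_connected G f -> branches_connected G f'.
Proof.
move=> bf.
have mono x y : f y = x.+1 -> connect [rel a b | [&& edge G a b, f' a == x.+1 & f' b == x.+1]] y x.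
  move=> /bf; apply: connect_sub => a b /and3P[ab /eqP fa /eqP fb].
  by apply: connect1; rewrite /= ab !copy_step_keep ?fa ?fb ?eqxx.
move=> y x; rewrite {1}/f' /copy_step; case: ifP => [/andP[c /eqP->]|_ /mono//].
move=> fw; have /and5P[_ /eqP fu _ _ /andP[_ uv]] := c.
have fux : f u = x.+1 by rewrite fu.
apply: connect_trans (mono x u fux); apply: connect1.
rewrite /= edge_sym uv (@copy_step_keep u) ?fux// eqxx andbT.
by rewrite /f' /copy_step c eqxx /= fw eqxx.
Qed.

Lemma flooding_copy_step : flooding w f -> flooding w f'.
Proof.
move=> F; have [c|c] := boolP (copies w u v f); last first.
  suff -> : f' = f by [].
  by apply/funext => x; rewrite /f' /copy_step (negbTE c).
have := c => /and5P[fw /eqP fuw /eqP Luw /eqP fv /andP[/eqP Lvu uv]].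
have f'v : f' v = f w by rewrite /f' /copy_step c eqxx.
have f'x x : x != v -> f' x = f x by move=> /negbTE xv; rewrite /f' /copy_step xv andbF.
have f'w : f' w = f w by rewrite copy_step_keep.
have f0v : f0 v = 0%N.
  by apply/eqP; apply: contraT => h; move: (h); rewrite -(flooding_keep F h) fv.
have sat x : saturated f x -> saturated f' x.
  by move=> S y xy Lxy; rewrite copy_step_keep S.
(* An assigned neighbour [y] of the free vertex [v] in its cluster cannot be saturated, so it
   belongs to the flood in progress. This is why the copy made at [v] agrees with all its newly
   assigned neighbours. *)
have front y : edge G v y -> L v = L y -> f0 y = 0%N -> f y != 0%N -> f y = f w.
  move=> vy Lvy f0y fy; have [[w' [/ord_inj-> //]]|] := flooding_front F f0y fy.
  by move=> /(_ v); rewrite edge_sym vy Lvy => /(_ isT erefl); rewrite fv.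
split.
- move=> x f0x; rewrite copy_step_keep (flooding_keep F)//.
- move=> x; have [->|xv] := eqVneq x v.
    rewrite f'v => _; have [w' [E1 E2 E3]] := flooding_source F fw.
    by exists w'; rewrite E1 E2 Lvu Luw; split=> //; rewrite -E1.
  by rewrite f'x// => /(flooding_source F).
- by move=> /(flooding_connected F); apply: branches_connected_copy_step.
- move=> x y xy Lxy f0x f0y.
  have [xv|xv] := eqVneq x v; have [yv|yv] := eqVneq y v.
  + by rewrite xv yv.
  + subst x; rewrite f'v (f'x y)// => _ fy; by rewrite front.
  + subst y; rewrite f'v (f'x x)// => fx _; rewrite front// edge_sym//.
  + by rewrite !f'x//; apply: (flooding_edge F xy Lxy f0x f0y).
- move=> x f0x; have [->|xv] := eqVneq x v.
    by move=> _; left; exists w; rewrite f'v f'w Lvu Luw.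
  rewrite f'x// => fx; have [[w' [/ord_inj-> Ex Lx]]|/sat ?] := flooding_front F f0x fx;
    last by right.
  by left; exists w; rewrite f'x // f'w.
- move=> w' w'w f0w' x y.
  have fw' : f w' = f0 w' := flooding_keep F f0w'.
  have f'w' : f' w' = f w' by rewrite copy_step_keep// fw'.
  have fl := flooding_before F w'w f0w'.
  apply/negP => /and5P[_ /eqP fx /eqP Lx /eqP fy /andP[/eqP Ly xy]].
  have fy0 : f y = 0%N.
    by apply/eqP; apply: contraT => h; move: (h); rewrite -(copy_step_keep h) -/f' fy.
  have [xv|xv] := eqVneq x v.
    (* then [w'] and [w] are the same source, which is already flooded *)
    have E : f u = f w' by rewrite fuw -f'v -xv fx.
    have := fl u v; rewrite /copies E fw' f0w' fv uv Lvu -Lx xv Lvu.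
    by rewrite !eqxx.
  have E : f x = f w' by rewrite -(f'x x xv) fx f'w'.
  have := fl x y; rewrite /copies E fw' f0w' fy0 xy Ly Lx.
  by rewrite !eqxx.
Qed.

End CopyStep.

(** When the flood of [w] is over, the vertices of its front have no free neighbour left in their
    cluster: [same_source] turns into [saturated]. *)
Lemma flooding_next w f : flooding w f -> flooded w f -> flooding w.+1 f.
Proof.
move=> F fl; split; try by case: F.
- move=> u f0u fu; right; have [[w' [/ord_inj-> E E']] v uv Luv|//] := flooding_front F f0u fu.
  apply: contraT => fv; have := fl u v.
  by rewrite /copies -E fu E' uv -Luv E' !eqxx andbT (negPn fv).
- move=> w1; rewrite ltnS leq_eqVlt => /orP[/eqP/ord_inj->//|].
  by move=> w1w; apply: (flooding_before F w1w).
Qed.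

Lemma flooding0 : flooding 0 f0.
Proof. by split=> //; [move=> u fu; exists u|move=> u v _ _ ->|move=> u ->]. Qed.

Lemma flooding_extends f : flooding n f -> extends G L f0 f.
Proof.
move=> F.
have closed u v : edge G u v -> L u = L v -> f u != 0%N -> f v != 0%N.
  move=> uv Luv fu; have [w [E Lw f0w]] := flooding_source F fu.
  have := flooding_before F (ltn_ord w) f0w.
  have fw := flooding_keep F f0w.
  move=> /(_ u v); rewrite /copies fw f0w E Lw -Luv uv !eqxx andbT /=.
  by rewrite andbT.
split=> //; first exact: (flooding_keep F).
- exact: (flooding_source F).
- move=> u v uv Luv f0u f0v; have [fu|fu] := eqVneq (f u) 0%N.
    apply/esym/eqP; rewrite fu; apply: contraT => fv.
    by have := closed v u; rewrite edge_sym uv fv fu Luv => /(_ isT erefl isT).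
  by apply: (flooding_edge F) => //; apply: closed fu.
- exact: (flooding_connected F).
Qed.

End FloodFill.

Definition rvar (a : nat) : rexp := RGet a (NConst 0) (NConst 0).
Definition nentry (a v : nat) : nexp := NGet a (nvar v) (NConst 0).
Definition NEq (e1 e2 : nexp) : bexp := BAnd (NLe e1 e2) (NLe e2 e1).
Definition edge_test (u v : nat) : bexp := NLe (NConst 1) (NGet 1 (nvar u) (nvar v)).

(* Arrays of naturals: 0, 1, 2 hold the input, 3 the edges of the minor, 4 the
   clusters, 5 the assignment, 10 to 13 loop counters, and 9 stays zero.  Arrays
   of reals: 0 holds the lengths, 1 the distances, 2 the argument of the
   decomposition, 3 an upper bound on the distances, 4 and 5 the current and the
   next scale. *)
Definition copy_cmd (lab : nat) : cmd :=
  If (BAnd (NLe (NConst 1) (nentry 5 13))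
     (BAnd (NEq (nentry 5 10) (nentry 5 13))
     (BAnd (NEq (nentry lab 10) (nentry lab 13))
     (BAnd (NLe (nentry 5 11) (NConst 0))
     (BAnd (NEq (nentry lab 11) (nentry lab 10))
           (edge_test 10 11))))))
    (NSet 5 (nvar 11) (NConst 0) (nentry 5 13)) Skip.

(** Counter 13 is the source and counters 10 and 11 scan the edges; counter 12 repeats the scan,
    since one scan need not exhaust the flood. *)
Definition spread_cmd (lab : nat) : cmd :=
  loop 13 (loop 12 (loop 10 (loop 11 (copy_cmd lab)))).

Definition spread_time (n : nat) : nat :=
  loop_time (loop_time (loop_time (loop_time 3 n) n) n) n.

Section Spread.
Variables (R : realType) (n : nat) (G : wgraph R n).
Implicit Types (m : store R) (u v w : 'I_n).

Definition column (a : nat) m : 'I_n -> nat := fun u => narr m a u 0.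

Definition adjacency_stored m : Prop :=
  narr m 0 0 0 = n /\ forall u v, narr m 1 u v = edge G u v.

Lemma column_nset a i j k a' m : a' != a -> column a' (nset m a i j k) = column a' m.
Proof. by move=> aa'; apply/funext => u; rewrite /column /= updC. Qed.

Lemma wp_copy lab m w u v :
  narr m 13 0 0 = w -> narr m 10 0 0 = u -> narr m 11 0 0 = v ->
  adjacency_stored m ->
  wp (copy_cmd lab) 3
     (fun m' => column 5 m' = copy_step G (column lab m) w u v (column 5 m)) m.
Proof.
move=> mw mu mv [_ adj]; apply: (wp_straight_line (c := copy_cmd lab)) => //.
rewrite /copy_cmd; set b := BAnd _ _.
have -> : effect (If b (NSet 5 (nvar 11) (NConst 0) (nentry 5 13)) Skip) m =
  if beval m b then nset m 5 v 0 (narr m 5 w 0) else m.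
  by rewrite /= mv mw.
have -> : beval m b = copies G (column lab m) w u v (column 5 m).
  by rewrite /copies /column /= mw mu mv adj lt0b -!eqn_leq lt0n leqn0.
apply/funext => x; rewrite /copy_step; case: ifP => c //=.
by rewrite /column /upd /= andbT.
Qed.

Lemma wp_spread lab m0 : lab \notin [:: 5; 10; 11; 12; 13]%N ->
  adjacency_stored m0 ->
  wp (spread_cmd lab) (spread_time n)
     (fun m => extends G (column lab m0) (column 5 m0) (column 5 m)) m0.
Proof.
move=> labP [n0 adj0].
set L := column lab m0; set f0 := column 5 m0.
pose fl k m := flooding G L f0 k (column 5 m).
have stored c m1 m : {subset nwrites c <= [:: 5; 10; 11; 12; 13]%N} ->
    adjacency_stored m1 -> agree_off c m1 m ->
    adjacency_stored m /\ column lab m = column lab m1.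
  move=> sub [m1n m1adj] [N _].
  have nin a : a \notin [:: 5; 10; 11; 12; 13]%N -> a \notin nwrites c.
    by apply: contra => /sub.
  by split; [split=> [|u v]|]; rewrite ?/column ?N ?nin.
have sub1 : {subset nwrites (spread_cmd lab) <= [:: 5; 10; 11; 12; 13]%N}.
  by apply/allP.
have sub2 : {subset nwrites (loop 12 (loop 10 (loop 11 (copy_cmd lab))))
    <= [:: 5; 10; 11; 12; 13]%N}.
  by apply/allP.
have sub3 : {subset nwrites (loop 10 (loop 11 (copy_cmd lab))) <= [:: 5; 10; 11; 12; 13]%N}.
  by apply/allP.
apply: (@wp_conseq _ _ (spread_time n) _ (fl n)) => //; last first.
  by move=> m _; apply: flooding_extends.
rewrite /spread_cmd /spread_time; apply: (@wp_loop _ 13%N _ n _ fl) => //.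
  exact: flooding0.
move=> w m1 ltwn A1 m1w fl1.
have [[m1n m1adj] m1L] := stored _ m0 _ sub1 (conj n0 adj0) A1.
pose wo := Ordinal ltwn.
(* After [t] rounds the flood is over or at least [t] vertices are assigned, so [n] rounds
   suffice. *)
pose J t m := fl w m /\ (flooded G L wo (column 5 m) \/
  (t <= #|[set x : 'I_n | column 5 m x != 0%N]|)%N).
apply: (@wp_conseq _ _ (loop_time (loop_time (loop_time 3 n) n) n) _ (J n)) => //; last first.
  move=> m _ [flm [fd|full]]; first exact: (@flooding_next _ _ _ _ _ wo).
  apply: (@flooding_next _ _ _ _ _ wo) => // u v; apply/negP => /and5P[_ _ _ /eqP fv _].
  have : v \in [set x : 'I_n | column 5 m x != 0%N].
    suff -> : [set x : 'I_n | column 5 m x != 0%N]%SET = [set: 'I_n]%SET by rewrite inE.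
    by apply/eqP; rewrite eqEcard finset.subsetT cardsT card_ord.
  by rewrite inE fv.
apply: (@wp_loop _ 12%N _ n _ J) => //.
  by split=> //; right.
move=> t m2 lttn A2 _ [fl2 J2].
have [st2 m2L] := stored _ m1 _ sub2 (conj m1n m1adj) A2.
have m2w : narr m2 13 0 0 = w by rewrite A2.1.
pose f2 := column 5 m2.
pose I m := [/\ fl w m, forall x, f2 x != 0%N -> column 5 m x = f2 x &
  flooded G L wo f2 -> column 5 m = f2].
(* [f2] is the assignment at the start of the round. A copy possible then is still possible when its
   edge is visited, unless [v] has been assigned meanwhile; so an unfinished flood gains a vertex in
   each round. *)
pose Q i j m := forall u v, u = i :> nat -> v = j :> nat ->
  copies G L wo u v f2 -> column 5 m v != 0%N.
apply: (@wp_conseq _ _ (loop_time (loop_time 3 n) n) _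
  (fun m => I m /\ forall i j, (i < n)%N -> (j < n)%N -> Q i j m)) => //; last first.
  move=> m _ [[flm keep same] Qm]; split=> //.
  case: J2 => [fd|card]; first by left; rewrite same.
  have [fd|nfd] := pselect (flooded G L wo f2); first by left; rewrite same.
  right; apply: leq_ltn_trans card _; apply: proper_card.
  apply/properP; split.
    by apply/fintype.subsetP => x; rewrite !inE => fx; rewrite keep.
  have [u [v c]] : exists u v, copies G L wo u v f2.
    apply: contrapT => nE; apply: nfd => u v; apply/negP => c.
    by apply: nE; exists u, v.
  exists v; rewrite !inE; first exact: Qm c.
  by case/and5P: c => _ _ _ -> _.
apply: (@wp_loop2 _ 10%N 11%N _ n _ I Q) => //.
- by move=> v k m; rewrite !inE => /orP[]/eqP-> [*]; split; rewrite /fl ?column_nset.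
- by move=> v k m i j; rewrite !inE => /orP[]/eqP-> ?; rewrite /Q column_nset.
- by case: st2.
move=> i j m ltin ltjn A3 mi mj [flm keep same].
have [st3 m3L] := stored _ m2 _ sub3 st2 A3.
have mw : narr m 13 0 0 = w by rewrite A3.1.
have mL : column lab m = L by rewrite m3L m2L m1L.
apply: (wp_conseq
  (wp_copy lab (w := wo) (u := Ordinal ltin) (v := Ordinal ltjn) mw mi mj st3)) => //.
move=> m' _; rewrite mL => E.
split; first split.
- by rewrite /fl E; apply: (@flooding_copy_step _ _ _ _ _ wo).
- by move=> x fx; rewrite E copy_step_keep keep.
- by move=> fd; rewrite E copy_step_flooded// same.
- move=> u v ui vj c; rewrite E.
  have -> : Ordinal ltin = u by apply/val_inj.
  have -> : Ordinal ltjn = v by apply/val_inj.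
  have [fv|fv] := eqVneq (column 5 m v) 0%N; last by rewrite copy_step_keep.
  apply: copy_step_copies; move: c; rewrite /copies => /and5P[c1 /eqP c2 c3 _ ->].
  have E1 : column 5 m wo = f2 wo by apply: keep.
  have E2 : column 5 m u = f2 u by apply: keep; rewrite c2.
  by rewrite E1 E2 c1 c2 c3 fv !eqxx.
- move=> i' j' q u v ui vj c; have h := q u v ui vj c.
  by rewrite E copy_step_keep.
Qed.

End Spread.

(** * Computing the distances *)

Definition sum_lengths_cmd : cmd :=
  loop 10 (loop 11 (RSet 3 (NConst 0) (NConst 0)
    (RAdd (rvar 3) (RGet 0 (nvar 10) (nvar 11))))).

(** On non-edges, [n] times the sum of the lengths stands in for infinity: it bounds every distance,
    as a shortest walk has fewer than [n] steps. *)
Definition init_distance_cmd : cmd :=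
  If (NEq (nvar 10) (nvar 11)) (RSet 1 (nvar 10) (nvar 11) (RNat (NConst 0)))
    (If (edge_test 10 11)
       (RSet 1 (nvar 10) (nvar 11) (RGet 0 (nvar 10) (nvar 11)))
       (RSet 1 (nvar 10) (nvar 11) (RMul (RNat (nvar 0)) (rvar 3)))).

Definition relax_cmd : cmd :=
  If (RLe (RGet 1 (nvar 10) (nvar 11))
          (RAdd (RGet 1 (nvar 10) (nvar 12)) (RGet 1 (nvar 12) (nvar 11))))
    Skip
    (RSet 1 (nvar 10) (nvar 11)
       (RAdd (RGet 1 (nvar 10) (nvar 12)) (RGet 1 (nvar 12) (nvar 11)))).

(** A pass over counters 12, 10 and 11 relaxes every pair through every vertex; counter 13 repeats
    it, each pass lengthening by one edge the walks accounted for. *)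
Definition distances_cmd : cmd :=
  Seq sum_lengths_cmd (Seq (loop 10 (loop 11 init_distance_cmd))
    (loop 13 (loop 12 (loop 10 (loop 11 relax_cmd))))).

Definition distances_time (n : nat) : nat :=
  (loop_time (loop_time 1 n) n +
   (loop_time (loop_time 5 n) n +
    loop_time (loop_time (loop_time (loop_time 3 n) n) n) n).+1).+1.

Section DistanceProgram.
Variables (R : realType) (n : nat) (G : wgraph R n).
Hypothesis G_connected : connected_graph G.
Implicit Types (m : store R) (u v w : 'I_n).

Definition lengths_stored m : Prop :=
  forall u v, rarr m 0 u v = if edge G u v then len G u v else 0.

Lemma lengths_stored_ge0 m u v : lengths_stored m -> 0 <= rarr m 0 u v.
Proof. by move=> ->; case: ifP => // /len_ge0. Qed.

Lemma upd_eq (X : Type) (h : nat -> nat -> nat -> X) a i j x i' j' :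
  upd h a i j x a i' j' = if (i' == i) && (j' == j) then x else h a i' j'.
Proof. by rewrite /upd eqxx. Qed.

Lemma wp_sum_lengths m0 : narr m0 0 0 0 = n -> lengths_stored m0 ->
  rarr m0 3 0 0 = 0 ->
  wp sum_lengths_cmd (loop_time (loop_time 1 n) n)
    (fun m => 0 <= rarr m 3 0 0 /\ forall u v, edge G u v -> len G u v <= rarr m 3 0 0) m0.
Proof.
move=> n0 len0 s0.
pose I m := 0 <= rarr m 3 0 0.
pose Q i j m := rarr m0 0 i j <= rarr m 3 0 0.
apply: (@wp_conseq _ _ (loop_time (loop_time 1 n) n) _
  (fun m => I m /\ forall i j, (i < n)%N -> (j < n)%N -> Q i j m)) => //; last first.
  move=> m _ [Im Qm]; split=> // u v uv.
  by have := Qm u v (ltn_ord u) (ltn_ord v); rewrite /Q len0 uv.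
apply: (@wp_loop2 _ 10%N 11%N _ n _ I Q) => //; first by rewrite /I s0.
move=> i j m ltin ltjn A mi mj Im.
apply: (wp_straight_line (c := RSet 3 _ _ _)) => //=.
have E : rarr m 0 i j = rarr m0 0 i j by rewrite A.2.
have h0 : 0 <= rarr m0 0 i j.
  exact: (lengths_stored_ge0 (Ordinal ltin) (Ordinal ltjn) len0).
rewrite mi mj E; split; rewrite /I /Q /= ?upd_eq ?eqxx /=.
- exact: addr_ge0.
- by rewrite lerDr.
- by move=> i' j' /le_trans; apply; rewrite ?upd_eq ?eqxx /= lerDl.
Qed.

Lemma gdist_le_bound (S : R) u v : 0 <= S ->
  (forall u v, edge G u v -> len G u v <= S) -> gdist G u v <= n%:R * S.
Proof.
move=> S0 lenS; have [s [ps _ szs <-]] := gdist_walk G_connected u v.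
apply: (@le_trans _ _ ((size s)%:R * S)); last first.
  by rewrite ler_wpM2r// ler_nat ltnW.
elim: s u ps {szs} => [|w s IH] u /=; first by rewrite mul0r.
move=> /andP[uw /IH le]; rewrite -natr1 mulrDl mul1r addrC.
by rewrite lerD// lenS.
Qed.

(** Cells outside the matrix are tracked because the array must finally equal [matr 0 (gdist G)] as
    a function, the input format of [D]. *)
Definition dominates_distances m : Prop :=
  (forall u v, gdist G u v <= rarr m 1 u v) /\
  (forall i j, ~~ ((i < n)%N && (j < n)%N) -> rarr m 1 i j = 0).

Definition below_walks t m : Prop := forall u s, path (edge G) u s ->
  (size s <= t.+1)%N -> rarr m 1 u (last u s) <= walk_len (len G) u s.

Lemma wp_init_distances m0 : adjacency_stored G m0 -> lengths_stored m0 ->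
  rarr m0 1 = (fun _ _ => 0) -> 0 <= rarr m0 3 0 0 ->
  (forall u v, edge G u v -> len G u v <= rarr m0 3 0 0) ->
  wp (loop 10 (loop 11 init_distance_cmd)) (loop_time (loop_time 5 n) n)
    (fun m => dominates_distances m /\ below_walks 0 m) m0.
Proof.
move=> [n0 adj0] len0 z0 S0 lenS.
pose I m := forall i j, ~~ ((i < n)%N && (j < n)%N) -> rarr m 1 i j = 0.
pose target i j : R := if i == j then 0 else if (0 < narr m0 1 i j)%N
  then rarr m0 0 i j else n%:R * rarr m0 3 0 0.
pose Q i j m := rarr m 1 i j = target i j.
apply: (@wp_conseq _ _ (loop_time (loop_time 5 n) n) _
  (fun m => I m /\ forall i j, (i < n)%N -> (j < n)%N -> Q i j m)) => //; last first.
  move=> m _ [Im Qm].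
  have E u v : rarr m 1 u v = if u == v then 0 else if edge G u v then len G u v
      else n%:R * rarr m0 3 0 0.
    rewrite Qm// /target adj0 lt0b len0 -val_eqE /=; case: ifP => // _.
    by case: (edge G u v).
  split; [split=> // u v|].
    rewrite E; have [->|_] := eqVneq u v; first by rewrite gdistxx.
    by case: ifP => [/(gdist_le_len G_connected)//|_]; apply: gdist_le_bound.
  move=> u [|v [|//]] /=; first by rewrite E eqxx.
  rewrite andbT => uv _; rewrite E addr0 uv.
  by case: ifP => // _; apply: len_ge0.
apply: (@wp_loop2 _ 10%N 11%N _ n _ I Q) => //; first by move=> ? ? _; rewrite z0.
move=> i j m ltin ltjn A mi mj Im.
apply: (wp_straight_line (c := init_distance_cmd)) => //.
have -> : effect init_distance_cmd m = rset m 1 i j (target i j).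
  rewrite /= mi mj (A.1 0%N)// (A.1 1%N)// (A.2 0%N)// (A.2 3%N)// n0.
  rewrite -eqn_leq /target; case: ifP => // _; by case: ifP.
split.
- move=> i' j' out; rewrite /= upd_eq; case: ifP => [/andP[/eqP Ei /eqP Ej]|_].
    by move: out; rewrite Ei Ej ltin ltjn.
  exact: Im.
- by rewrite /Q /= upd_eq !eqxx.
- move=> i' j' q; rewrite /Q /= upd_eq; case: ifP => // /andP[/eqP Ei /eqP Ej].
  by rewrite Ei Ej.
Qed.

Lemma wp_relax m0 : narr m0 0 0 0 = n ->
  dominates_distances m0 -> below_walks 0 m0 ->
  wp (loop 13 (loop 12 (loop 10 (loop 11 relax_cmd))))
     (loop_time (loop_time (loop_time (loop_time 3 n) n) n) n)
     (fun m => rarr m 1 = matr 0 (gdist G)) m0.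
Proof.
move=> n0 dom0 walks0.
pose I t m := dominates_distances m /\ below_walks t m.
apply: (@wp_conseq _ _ (loop_time (loop_time (loop_time (loop_time 3 n) n) n) n) _ (I n)) => //;
    last first.
  move=> m _ [[ge out] le]; apply/funext => i; apply/funext => j; rewrite /matr.
  case: insubP => [u _ <-|iP]; last by rewrite out// (negbTE iP).
  case: insubP => [v _ <-|jP]; last by rewrite out// (negbTE jP) andbF.
  apply/eqP; rewrite eq_le ge andbT.
  have [s [ps ls szs <-]] := gdist_walk G_connected u v.
  by rewrite -[in leLHS]ls le// (leq_trans (ltnW szs)).
apply: (@wp_loop _ 13%N _ n _ I) => // t m1 _ A1 _ [dom1 walks1].
have n1 : narr m1 0 0 0 = n by rewrite A1.1.
(* The matrix at the start of the pass. Entries read later may have decreased already, which only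
   helps. *)
pose D i j := rarr m1 1 i j.
pose below m := forall i j, rarr m 1 i j <= D i j.
pose J k m := [/\ dominates_distances m, below m &
  forall k' i j, (k' < k)%N -> (i < n)%N -> (j < n)%N ->
    rarr m 1 i j <= D i k' + D k' j].
apply: (@wp_conseq _ _ (loop_time (loop_time (loop_time 3 n) n) n) _ (J n)) => //; last first.
  move=> m _ [dom blw short]; split=> // u [|v s].
    by move=> _ _; apply: le_trans (blw _ _) (walks1 _ [::] _ _).
  move=> /andP[uv vs] /=; rewrite ltnS => sz.
  apply: le_trans (short v u (last v s) _ _ _) _ => //.
  apply: lerD; last exact: walks1.
  by have := walks1 u [:: v]; rewrite /= uv addr0; apply.
apply: (@wp_loop _ 12%N _ n _ J) => // [|k m2 ltkn A2 m2k [dom2 blw2 short2]].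
  by split=> // i j; apply: lexx.
have n2 : narr m2 0 0 0 = n by rewrite A2.1.
pose I' m := [/\ dominates_distances m, below m &
  forall k' i j, (k' < k)%N -> (i < n)%N -> (j < n)%N ->
    rarr m 1 i j <= D i k' + D k' j].
pose Q i j m := rarr m 1 i j <= D i k + D k j.
apply: (@wp_conseq _ _ (loop_time (loop_time 3 n) n) _
  (fun m => I' m /\ forall i j, (i < n)%N -> (j < n)%N -> Q i j m)) => //; last first.
  move=> m _ [[dom blw short] Qm]; split=> // k' i j.
  by rewrite ltnS leq_eqVlt => /orP[/eqP->|]; [apply: Qm|apply: short].
apply: (@wp_loop2 _ 10%N 11%N _ n _ I' Q) => //.
move=> i j m ltin ltjn A mi mj [dom blw short].
have mk : narr m 12 0 0 = k by rewrite A.1.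
apply: (wp_straight_line (c := relax_cmd)) => //.
have E i' j' : rarr (effect relax_cmd m) 1 i' j' =
    if (i' == i) && (j' == j) then Num.min (rarr m 1 i j) (rarr m 1 i k + rarr m 1 k j)
    else rarr m 1 i' j'.
  rewrite /= mi mj mk; case: leP => c /=; rewrite ?upd_eq//.
  by case: ifP => // /andP[/eqP-> /eqP->].
have le i' j' : rarr (effect relax_cmd m) 1 i' j' <= rarr m 1 i' j'.
  by rewrite E; case: ifP => // /andP[/eqP-> /eqP->]; rewrite ge_min lexx.
split; first split.
- split=> [u v|i' j' out].
    rewrite E; case: ifP => [/andP[/eqP Ei /eqP Ej]|_]; last exact: dom.1.
    rewrite le_min -Ei -Ej dom.1/= -[k]/(val (Ordinal ltkn)).
    by apply: le_trans (gdist_triangle G_connected (Ordinal ltkn) u v) _; rewrite lerD ?dom.1.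
  rewrite E; case: ifP => [/andP[/eqP Ei /eqP Ej]|_]; last exact: dom.2.
  by move: out; rewrite Ei Ej ltin ltjn.
- by move=> i' j'; apply: le_trans (le _ _) (blw _ _).
- by move=> k' i' j' k'k i'n j'n; apply: le_trans (le _ _) (short _ _ _ k'k i'n j'n).
- rewrite /Q E !eqxx /= ge_min; apply/orP; right.
  by rewrite lerD.
- by move=> i' j'; apply: le_trans.
Qed.

Lemma wp_distances m0 : adjacency_stored G m0 -> lengths_stored m0 ->
  rarr m0 1 = (fun _ _ => 0) -> rarr m0 3 0 0 = 0 ->
  wp distances_cmd (distances_time n) (fun m => rarr m 1 = matr 0 (gdist G)) m0.
Proof.
move=> [n0 adj0] len0 z0 s0.
apply: wp_seq; apply: (wp_conseq (wp_sum_lengths n0 len0 s0)) => // m1 A1 [S0 lenS].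
have st1 : adjacency_stored G m1.
  by split=> [|u v]; rewrite A1.1.
apply: wp_seq.
apply: (wp_conseq (wp_init_distances st1 _ _ S0 lenS)) => //.
- by move=> u v; rewrite A1.2.
- by rewrite A1.2.
move=> m2 A2 [dom walks]; apply: wp_relax => //.
by rewrite A2.1// A1.1.
Qed.

End DistanceProgram.

(** * The main loop *)

(** The value [0] of real variable 5 means that no candidate was found yet; as scales are positive,
    it also ends the main loop. *)
Definition scale_test_cmd : cmd :=
  If (BAnd (BNot (RLe (RGet 1 (nvar 10) (nvar 11)) (RNat (NConst 0))))
     (BAnd (RLe (RAdd (rvar 4) (rvar 4)) (RGet 1 (nvar 10) (nvar 11)))
        (BNot (BAnd (BNot (RLe (rvar 5) (RNat (NConst 0))))
                    (RLe (rvar 5) (RGet 1 (nvar 10) (nvar 11)))))))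
    (RSet 5 (NConst 0) (NConst 0) (RGet 1 (nvar 10) (nvar 11))) Skip.

Definition next_scale_cmd : cmd :=
  Seq (RSet 5 (NConst 0) (NConst 0) (RNat (NConst 0)))
    (loop 10 (loop 11 scale_test_cmd)).

Definition next_scale_time (n : nat) : nat := (1 + loop_time (loop_time 3 n) n).+1.

Definition after_call_cmd : cmd :=
  Seq (spread_cmd 4) (Seq (RSet 4 (NConst 0) (NConst 0) (rvar 5)) next_scale_cmd).

Definition after_call_time (n : nat) : nat :=
  (spread_time n + (1 + next_scale_time n).+1).+1.

Definition level_cmd : cmd :=
  Seq (RSet 2 (NConst 0) (NConst 0) (RMul (rvar 5) (RInv (RNat (NConst 2)))))
    (Seq (Call 0 1 2 4) after_call_cmd).

Definition main_loop_cmd : cmd :=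
  While (BNot (RLe (rvar 5) (RNat (NConst 0)))) level_cmd.

Section MainLoop.
Variables (R : realType) (n : nat) (G : wgraph R n) (K : {set 'I_n}).
Hypothesis G_connected : connected_graph G.
Implicit Types (m : store R) (u v w : 'I_n).

(** That the new scale is itself a distance makes [candidates] lose a pair, which bounds the number
    of levels. *)
Definition scale_found (r x : R) : Prop :=
  (x = 0 /\ last_scale G r) \/
  (next_scale G r x /\ exists u v, gdist G u v = x).

Lemma wp_next_scale m0 : narr m0 0 0 0 = n -> rarr m0 1 = matr 0 (gdist G) ->
  wp next_scale_cmd (next_scale_time n)
    (fun m => scale_found (rarr m0 4 0 0) (rarr m 5 0 0)) m0.
Proof.
move=> n0 M0; apply: wp_seq; apply: (wp_straight_line (c := RSet 5 _ _ _)) => //.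
set m1 := effect _ m0; set r := rarr m0 4 0 0.
have n1 : narr m1 0 0 0 = n by [].
have M1 : rarr m1 1 = matr 0 (gdist G) by rewrite -M0.
have r1 : rarr m1 4 0 0 = r by [].
have x1 : rarr m1 5 0 0 = 0 by [].
pose I m := rarr m 5 0 0 = 0 \/
  exists u v, [/\ rarr m 5 0 0 = gdist G u v, 0 < gdist G u v & 2 * r <= gdist G u v].
pose Q i j m := forall u v, u = i :> nat -> v = j :> nat -> 0 < gdist G u v ->
  2 * r <= gdist G u v -> 0 < rarr m 5 0 0 <= gdist G u v.
apply: (@wp_conseq _ _ (loop_time (loop_time 3 n) n) _
  (fun m => I m /\ forall i j, (i < n)%N -> (j < n)%N -> Q i j m)) => //; last first.
  move=> m _ [Im Qm].
  have Q' u v := Qm u v (ltn_ord u) (ltn_ord v) u v erefl erefl.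
  case: Im => [x0|[u [v [xE d0 dr]]]]; [left|right].
    split=> // u v d0; rewrite ltNge; apply/negP => dr.
    by have := Q' u v d0 dr; rewrite x0 ltxx.
  split; last by exists u, v.
  split; rewrite ?xE// => u' v' d0' dr'.
  by rewrite -xE; have /andP[] := Q' u' v' d0' dr'.
apply: (@wp_loop2 _ 10%N 11%N _ n _ I Q) => //; first by left.
move=> i j m ltin ltjn A mi mj Im.
apply: (wp_straight_line (c := scale_test_cmd)) => //.
pose io := Ordinal ltin; pose jo := Ordinal ltjn.
set x := rarr m 5 0 0; set d := gdist G io jo.
have Mij : rarr m 1 i j = d.
  by rewrite A.2// M1 -[i]/(val io) -[j]/(val jo) /matr !valK.
have E : rarr (effect scale_test_cmd m) 5 0 0 =
  if [&& 0 < d, 2 * r <= d & ~~ ((0 < x) && (x <= d))] then d else x.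
  rewrite /= mi mj Mij -!ltNge (A.2 4%N)// r1 -mulr2n -(mulr_natl r 2) -/x.
  by case: ifP => _ //=; rewrite ?upd_eq.
split.
- rewrite /I E; case: ifP => [/and3P[d0 dr _]|_]; last exact: Im.
  by right; exists io, jo.
- move=> u v ui vj d0 dr; rewrite E.
  have -> : u = io by apply/val_inj.
  have -> : v = jo by apply/val_inj.
  rewrite -/d; have [d0' dr'] : 0 < d /\ 2 * r <= d.
    have <- : gdist G u v = d by congr gdist; apply/val_inj.
    by [].
  rewrite d0' dr' /=; case: ifPn => [_|]; first by rewrite d0' lexx.
  by rewrite negbK.
- move=> i' j' q u v ui vj d0 dr; have := q u v ui vj d0 dr; rewrite -/x E.
  case: ifPn => // /and3P[d0' _]; rewrite negb_and => /orP[/negbTE->//|].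
  by rewrite -ltNge d0' => dx /andP[_ xd]; rewrite (le_trans (ltW dx)).
Qed.

(** Whole arrays are fixed, out-of-range cells included, because [Call] must enter exactly the store
    [metric_input] for which [D] is known to work. Array 9 provides the single cluster of the last
    flood. *)
Record loop_state m : Prop := LoopState {
  state_size : narr m 0 = cell 0%N n;
  state_adjacency : forall u v, narr m 1 u v = edge G u v;
  state_output : narr m 3 = (fun _ _ => 0%N);
  state_zero : narr m 9 = (fun _ _ => 0%N);
  state_distances : rarr m 1 = matr 0 (gdist G);
  state_argument : forall i j, ~~ ((i == 0%N) && (j == 0%N)) -> rarr m 2 i j = 0;
  state_scale_ge0 : 0 <= rarr m 4 0 0;
  state_assignment : assignment G K (column 5 m) (rarr m 4 0 0);
  state_next : scale_found (rarr m 4 0 0) (rarr m 5 0 0) }.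

Lemma wp_after_call m0 :
  narr m0 0 = cell 0%N n -> (forall u v, narr m0 1 u v = edge G u v) ->
  narr m0 3 = (fun _ _ => 0%N) -> narr m0 9 = (fun _ _ => 0%N) ->
  rarr m0 1 = matr 0 (gdist G) ->
  (forall i j, ~~ ((i == 0%N) && (j == 0%N)) -> rarr m0 2 i j = 0) ->
  0 <= rarr m0 4 0 0 -> assignment G K (column 5 m0) (rarr m0 4 0 0) ->
  next_scale G (rarr m0 4 0 0) (rarr m0 5 0 0) ->
  diam_le G (column 4 m0) (2 * rarr m0 4 0 0) ->
  wp after_call_cmd (after_call_time n)
    (fun m => [/\ loop_state m, rarr m 4 0 0 = rarr m0 5 0 0 &
                 extends G (column 4 m0) (column 5 m0) (column 5 m)]) m0.
Proof.
move=> N0 adj0 out0 z0 M0 arg0 r0 af nx D.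
have n0 : narr m0 0 0 0 = n by rewrite N0.
apply: wp_seq; apply: (wp_conseq (@wp_spread _ _ G 4 m0 isT (conj n0 adj0))) => // m1 A1 ext.
apply: wp_seq; apply: (wp_straight_line (c := RSet 4 _ _ _)) => //.
set m2 := effect _ m1.
have M2 : rarr m2 1 = matr 0 (gdist G) by rewrite -M0 -(A1.2 1%N).
have N2 : narr m2 0 = cell 0%N n by rewrite -N0 -(A1.1 0%N).
have n2 : narr m2 0 0 0 = n by rewrite N2.
have r2 : rarr m2 4 0 0 = rarr m0 5 0 0 by rewrite -(A1.2 5%N).
apply: (wp_conseq (wp_next_scale n2 M2)) => // m3 A3 found.
have c3 : column 5 m3 = column 5 m1 by rewrite /column A3.1.
have r3 : rarr m3 4 0 0 = rarr m0 5 0 0 by rewrite A3.2.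
split=> //; last by rewrite c3.
split.
- by rewrite A3.1.
- by move=> u v; rewrite A3.1// -(adj0 u v) -(A1.1 1%N).
- by rewrite A3.1// -out0 -(A1.1 3%N).
- by rewrite A3.1// -z0 -(A1.1 9%N).
- by rewrite A3.2.
- by move=> i j ij; rewrite A3.2// -(arg0 i j ij) -(A1.2 2%N).
- by rewrite r3; case: nx => /ltW.
- by rewrite r3 c3; apply: assignment_extends af D _ ext; case: nx.
- by rewrite r3 -r2.
Qed.

Definition candidates (r : R) : {set 'I_n * 'I_n} :=
  [set p | (0 < gdist G p.1 p.2) && (2 * r <= gdist G p.1 p.2)]%SET.

Lemma candidates_decrease r x : 0 <= r -> next_scale G r x ->
  (exists u v, gdist G u v = x) -> (#|candidates x| < #|candidates r|)%N.
Proof.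
move=> r0 [x0 rx _] [u [v uvx]]; apply: proper_card; apply/properP; split.
  apply/fintype.subsetP => p; rewrite !inE => /andP[-> xp] /=.
  by apply: le_trans xp; lra.
exists (u, v); rewrite !inE /= uvx x0//=.
by rewrite -ltNge; lra.
Qed.

Lemma candidates_le r : (#|candidates r| <= n * n)%N.
Proof. by apply: leq_trans (max_card _) _; rewrite card_prod !card_ord. Qed.

Lemma separated_output m u v :
  Defs.separated (partition_output n m) u v = (narr m 1 u 0 != narr m 1 v 0).
Proof.
rewrite /Defs.separated /partition_output /preim_partition /equivalence_partition.
apply/existsP/idP => [[S /andP[/imsetP[w _ ->]]]|uv].
  rewrite !inE /= => /andP[/eqP <-]; apply: contraNneq => ->.
  by rewrite eqxx.
exists [set y in [set: 'I_n] | narr m 1 u 0 == narr m 1 y 0]%SET; apply/andP; split.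
  by apply/imsetP; exists u; rewrite ?inE.
by rewrite !inE eqxx uv.
Qed.

Lemma bounded_output (Delta : R) m :
  bounded_partition (gdist G) Delta (partition_output n m) ->
  diam_le G (column 1 m) Delta.
Proof.
move=> [_ bd] u v uv.
apply: (bd [set y in [set: 'I_n] | narr m 1 u 0 == narr m 1 y 0]%SET).
- by apply/imsetP; exists u; rewrite ?inE.
- by rewrite !inE eqxx.
- by rewrite !inE /=; apply/eqP.
Qed.

Variables (D : cmd) (p : {poly nat}) (beta : R).
Hypothesis D_decomposes : decomposable D p beta (gdist G).

(* The bound [g] on the next value of [Phi] depends on the clustering only, which
   is all that is random. *)
Definition supermartingale (Phi : R -> ('I_n -> nat) -> R) : Prop :=
  forall (r rp : R) f (T : Type) (mu : fdist R T) (lab : T -> 'I_n -> nat),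
  0 <= r -> assignment G K f r -> next_scale G r rp ->
  nonneg_weights mu -> \sum_(p <- mu) p.1 = 1 ->
  (forall x y, fprob mu (fun t => lab t x != lab t y) <= 2 * beta * gdist G x y / rp) ->
  exists g : ('I_n -> nat) -> R,
  [/\ forall lb f', diam_le G lb (2 * r) -> extends G lb f f' -> Phi rp f' <= g lb,
      forall lb, 0 <= g lb &
      (fexpect mu (fun t => (g (lab t))%:E) <= (Phi r f)%:E)%E].

Variables (F : config R -> \bar R) (k : seq (frame R)) (T0 : nat).
Variable Phi : R -> ('I_n -> nat) -> R.
Hypothesis F_ge0 : forall s, (0 <= F s)%E.
Hypothesis Phi_super : supermartingale Phi.
Hypothesis Phi_exit : forall m, loop_state m -> last_scale G (rarr m 4 0 0) ->
  forall T, (T0 <= T)%N ->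
    (ev D T F (k, m) <= (Phi (rarr m 4 0 0) (column 5 m))%:E)%E.

Definition level_time : nat := (after_call_time n + p.[n] + 6)%N.

(** By induction on a bound [N] for the number of pairs whose distance can still serve as a
    scale. *)
Lemma ev_main_loop N m : loop_state m -> (#|candidates (rarr m 4 0 0)| <= N)%N ->
  forall T, (T0 + 1 + N * level_time <= T)%N ->
    (ev D T F (Do R main_loop_cmd :: k, m) <=
     (Phi (rarr m 4 0 0) (column 5 m))%:E)%E.
Proof.
elim: N m => [|N IH] m st candN T ltT.
  case: (state_next st) => [[x0 last]|[nx xd]]; last first.
    by have := candidates_decrease (state_scale_ge0 st) nx xd; rewrite ltnNge (leq_trans candN).
  case: T ltT => [|T] ltT; first by rewrite addn1 in ltT.
  rewrite /= fexpect_fret x0 /= lexx /=; apply: Phi_exit => //; lia.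
have [[x0 last]|[nx xd]] := state_next st.
  case: T ltT => [|T] ltT; first by rewrite addn1 in ltT.
  rewrite /= fexpect_fret x0 /= lexx /=; apply: Phi_exit => //; lia.
set r := rarr m 4 0 0 in nx *; set x := rarr m 5 0 0 in nx xd.
have x0 : 0 < x by case: nx.
have r0 : 0 <= r := state_scale_ge0 st.
have [T' TE] : exists T', T = (5 + T')%N by exists (T - 5)%N; move: ltT; rewrite /level_time; lia.
rewrite {}TE in ltT *.
set m1 := rset m 2 0 0 (x * 2^-1).
(* Five steps lead into the subroutine: the loop test, two [Seq], one [RSet] and the [Call]. The
   sixth in [level_time] is the return. *)
have -> : ev D (5 + T') F (Do R main_loop_cmd :: k, m) =
  ev D T' F ([:: Do R D] ++ Return 4 m1 :: Do R after_call_cmd :: Do R main_loop_cmd :: k,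
             enter m1 0 1 2).
  by rewrite /= fexpect_fret /= -ltNge x0 /= !fexpect_fret.
have -> : enter m1 0 1 2 = metric_input (gdist G) (x / 2).
  rewrite /enter /metric_input; congr Store; apply/funext => -[|[|a]] //=.
  - exact: state_size st.
  - exact: state_distances st.
  - apply/funext => i; apply/funext => j; rewrite upd_eq /cell; case: ifP => // ij.
    by apply: (state_argument st); rewrite ij.
have x20 : 0 < x / 2 by rewrite divr_gt0.
have [mu [[halts muE] bounded sep]] := D_decomposes x20.
set runD := run D D (metric_input (gdist G) (x / 2)) p.[n] in halts muE.
pose lab (s : config R) : 'I_n -> nat := column 1 s.2.
(* The parameter is half of the scale [x], hence the factor 2 on [beta]. *)
have sepD u v : fprob runD (fun s => lab s u != lab s v) <= 2 * beta * gdist G u v / x.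
  have := sep u v; rewrite muE /outcome !fprob_fmap.
  have -> : (fun s : config R => Defs.separated (partition_output n s.2) u v) =
            (fun s => lab s u != lab s v).
    by apply/funext => s; rewrite separated_output.
  move=> /le_trans; apply; rewrite invfM invrK.
  by rewrite le_eqVlt; apply/orP; left; apply/eqP; ring.
have diamD : almost_surely runD (fun s => s.1 = [::] /\ diam_le G (lab s) (2 * r)).
  apply: almost_surely_and => //.
  have : almost_surely runD (fun s => bounded_partition (gdist G) (x / 2) (partition_output n s.2)).
    by move: bounded; rewrite muE => /almost_surely_fmap/almost_surely_fmap.
  by apply: almost_surely_imp => s /bounded_output; apply: next_scale_diam.
have wrun : \sum_(q <- runD) q.1 = 1 by apply: weight_run.
have nrun : nonneg_weights runD by apply: nonneg_weights_run.
have [g [gle g0 gE]] := Phi_super r0 (state_assignment st) nx nrun wrun sepD.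
(* [ev_stack_cat] wants a bound for every returned store; those with too large clusters get [+oo]
   and have weight zero. *)
pose h m' := (if `[< diam_le G (column 1 m') (2 * r) >] then (g (column 1 m'))%:E else +oo)%E.
have h0 m' : (0 <= h m')%E by rewrite /h; case: ifP => _; rewrite ?lee_fin.
apply: le_trans gE.
apply: le_trans (@ev_stack_cat _ _ F _ [:: Do R D] _ h p.[n]
  (1 + after_call_time n + (T0 + 1 + N * level_time)) T' F_ge0 h0 _ _) _.
- move=> m' T'' ltT''.
  rewrite /h; case: asboolP => [diam|_]; last exact: leey.
  have [T3 TE] : exists T3, T'' = (1 + T3)%N by exists (T'' - 1)%N; lia.
  rewrite {}TE in ltT'' *; rewrite /= fexpect_fret.
  set m2 := leave m1 m' 4.
  have c2 : column 4 m2 = column 1 m' by [].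
  have [|||||||||| m3 [t3 [E3 le3 [st3 r3 ext]]]] := @wp_after_call m2.
  + exact: state_size st.
  + exact: state_adjacency st.
  + exact: state_output st.
  + exact: state_zero st.
  + exact: state_distances st.
  + move=> i j ij; rewrite -(state_argument st ij).
    by rewrite /= upd_eq (negbTE ij).
  + exact: r0.
  + exact: state_assignment st.
  + exact: nx.
  + by rewrite c2.
  have [T4 TE] : exists T4, T3 = (t3 + T4)%N by exists (T3 - t3)%N; lia.
  rewrite {}TE in ltT'' *; rewrite (exec_ev _ E3).
  apply: le_trans (IH m3 st3 _ _ _) _.
  + rewrite r3 -ltnS; apply: leq_trans candN.
    exact: candidates_decrease.
  + lia.
  + by rewrite lee_fin r3; apply: gle.
- by move: ltT; rewrite /level_time; lia.
rewrite -fexpect_run; last by move=> s; case: ifP.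
apply: le_fexpect => //; apply: almost_surely_imp diamD => s [s1 diam].
by rewrite asboolT// /h asboolT.
Qed.

End MainLoop.

(** * The contracted graph *)

Section WalkPotential.
Variables (R : realType) (n : nat) (G : wgraph R n) (K : {set 'I_n}).
Hypothesis G_connected : connected_graph G.
Variable beta : R.
Hypothesis beta2 : 2 <= beta.
Implicit Types (u v w x y z : 'I_n).

Definition initial_assignment (u : 'I_n) : nat := if u \in K then u.+1 else 0%N.

Lemma assignment_initial : assignment G K initial_assignment 0.
Proof.
split.
- by move=> x xK; rewrite /initial_assignment xK.
- move=> u; rewrite /initial_assignment; case: ifP => // uK _.
  by exists u; rewrite uK gdistxx// mulr0.
- move=> u x; rewrite /initial_assignment; case: ifP => // _ [] /ord_inj->.
  exact: connect0.
Qed.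

Lemma exists_nearest u v x0 : x0 \in K -> exists a z,
  [/\ a \in [:: u; v], z \in K & forall x, x \in K ->
      gdist G a z <= gdist G u x /\ gdist G a z <= gdist G v x].
Proof.
move=> x0K.
have nearest w : exists2 z, z \in K & forall x, x \in K -> gdist G w z <= gdist G w x.
  case: (Order.TotalTheory.arg_minP (gdist G w) x0K) => z zK zmin.
  by exists z.
have [zu zuK umin] := nearest u; have [zv zvK vmin] := nearest v.
have [le|/ltW le] := leP (gdist G u zu) (gdist G v zv).
- exists u, zu; split=> // [|x xK]; first by rewrite mem_head.
  by split; [apply: umin|apply: le_trans le (vmin _ _)].
- exists v, zv; split=> // [|x xK]; first by rewrite !inE eqxx orbT.
  by split; [apply: le_trans le (umin _ _)|apply: vmin].
Qed.

Let C : R := 322 / ln 2.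

(** As [log2 beta >= 1], the constant also absorbs the edges with exactly one terminal end, whose
    initial potential is at most [33 * beta * l]. *)
Lemma distortion_ge : 322 * beta <= C * (beta * ln beta).
Proof.
have beta2_ := beta2; have L2 := @ln2_gt0 R.
have h1 : 1 <= ln beta / ln 2 by rewrite ler_pdivlMr// mul1r ler_ln ?posrE//; lra.
have -> : C * (beta * ln beta) = 322 * beta * (ln beta / ln 2) by rewrite /C; ring.
have beta0 : 0 <= beta by lra.
by apply: ler_peMr => [|//]; apply: mulr_ge0 => [|//]; apply: ler0n.
Qed.

Lemma potential_initial u v a z : edge G u v ->
  potential G u v a z (2 * beta) 0 initial_assignment
    <= C * (beta * ln beta) * len G u v.
Proof.
move=> uv; have l0 : 0 <= len G u v by apply: len_ge0.
have beta2_ := beta2; have C322 := distortion_ge.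
have H : 322 * beta * len G u v <= C * (beta * ln beta) * len G u v.
  by rewrite ler_wpM2r.
have bl : len G u v <= beta * len G u v by rewrite ler_peMl//; lra.
have b1 : 1 <= 2 * beta by lra.
have hc := half_cost_le b1 l0 (lexx 0).
rewrite /potential /initial_assignment.
case: (boolP (u \in K)) => uK; case: (boolP (v \in K)) => vK /=.
- by rewrite code_distE; have := gdist_le_len G_connected uv; lra.
- by rewrite code_distxx//; lra.
- by rewrite code_distxx//; lra.
- by apply: free_cost_0_le => //; apply: gdist_ge0.
Qed.

(** Supermartingales add up, whatever the dependence between the edges, so the potentials along the
    walk are summed; a nonempty [K] provides the nearest terminals. *)
Lemma walk_supermartingale u s : path (edge G) u s -> K != finset.set0 ->
  exists Phi, [/\ supermartingale G K beta Phi,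
    forall r f f', 0 <= r -> assignment G K f r -> last_scale G r ->
      extends G (fun=> 0%N) f f' ->
      walk_len (fun v w => code_dist G (f' v) (f' w)) u s <= Phi r f &
    Phi 0 initial_assignment <= C * (beta * ln beta) * walk_len (len G) u s].
Proof.
move=> + /set0Pn[x0 x0K]; elim: s u => [|v s IH] u.
  move=> _; exists (fun _ _ => 0); split=> //; last by rewrite mulr0.
  move=> r rp f T mu lab _ _ _ _ mu1 _; exists (fun=> 0); split=> //.
  by rewrite fexpect_cst mulr0.
move=> /andP[uv /IH[Phi [super exit init]]].
have [a [z [auv zK zmin]]] := exists_nearest u v x0K.
have b1 : 1 <= 2 * beta by have := beta2; lra.
exists (fun r f => potential G u v a z (2 * beta) r f + Phi r f); split.
- move=> r rp f T mu lab r0 af nx mu0 mu1 sep.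
  have [g1 [le1 g10 E1]] := potential_step G_connected b1 uv auv zK zmin r0 af nx mu0 mu1 sep.
  have [g2 [le2 g20 E2]] := super r rp f T mu lab r0 af nx mu0 mu1 sep.
  exists (fun lb => g1 lb + g2 lb); split.
  + by move=> lb f' D ext; rewrite lerD ?le1 ?le2.
  + by move=> lb; rewrite addr_ge0.
  + by rewrite fexpectD EFinD leeD.
- move=> r f f' r0 af last ext /=; apply: lerD; last exact: exit ext.
  exact: (potential_last G_connected a z b1 uv r0 af last ext).
- by rewrite /= mulrDr lerD// potential_initial.
Qed.

End WalkPotential.

Section ContractedGraph.
Variables (R : realType) (n : nat) (G : wgraph R n) (K : {set 'I_n}).
Hypothesis G_connected : connected_graph G.
Implicit Types (u v w x y : 'I_n).
Variables (f : 'I_n -> nat) (r : R) (eH : rel 'I_n).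
Hypothesis f_assigns : assignment G K f r.

Definition contracted_edge x y : Prop :=
  exists u v, [/\ edge G u v, f u = x.+1, f v = y.+1 & x != y].

Hypothesis eHP : forall x y, eH x y <-> contracted_edge x y.

Lemma is_minor_contracted : is_minor G K eH.
Proof.
have inK u x : f u = x.+1 -> x \in K.
  move=> fu; have [|y [yK fy _]] := assignment_dist f_assigns (u := u); first by rewrite fu.
  by move: fy; rewrite fu => -[/ord_inj->].
split.
- move=> x y; apply/idP/idP => /eHP[u [v [uv fu fv xy]]]; apply/eHP;
    by exists v, u; rewrite edge_sym eq_sym.
- by move=> x; apply/negP => /eHP[u [v [_ _ _]]]; rewrite eqxx.
- by move=> x y /eHP[u [v [_ /inK-> /inK-> _]]].
exists (fun x => [set u | f u == x.+1]%SET); split.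
- by move=> x xK; rewrite inE (assignment_terminal f_assigns).
- move=> x xK u v; rewrite !inE => /eqP fu /eqP fv.
  set e := (X in connect X).
  have eE : e =2 [rel a b | [&& edge G a b, f a == x.+1 & f b == x.+1]].
    by move=> a b; rewrite /e /= !inE.
  have e_sym : connect_sym e.
    by apply: sym_connect_sym => a b; rewrite !eE /= edge_sym [_ && (f b == _)]andbC.
  apply: (@connect_trans _ _ x); rewrite ?(e_sym x) !(eq_connect eE);
    exact: (assignment_connected f_assigns).
- move=> x y xK yK xy; rewrite -setI_eq0; apply/eqP/setP => u; rewrite !inE.
  apply/negP => /andP[/eqP-> /eqP[/ord_inj E]].
  by rewrite E eqxx in xy.
- move=> x y /eHP[u [v [uv fu fv _]]]; exists u, v.
  by rewrite !inE fu fv !eqxx.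
Qed.

Variable lH : 'I_n -> 'I_n -> R.
Hypothesis lHE : forall x y, eH x y -> lH x y = gdist G x y.

Lemma gdist_le_spdist x y : ((gdist G x y)%:E <= spdist eH lH x y)%E.
Proof.
apply: le_ereal_inf_tmp => _ [s [ps <-] <-]; rewrite lee_fin.
elim: s x ps => [|w s IH] x /=; first by rewrite gdistxx.
move=> /andP[xw /IH le]; rewrite lHE//.
exact: le_trans (gdist_triangle G_connected w x _) (lerD (lexx _) le).
Qed.

(** The codes along the walk, with consecutive repetitions dropped, form a walk in the contracted
    graph; a dropped step has length zero. *)
Lemma spdist_le_walk x y u s : (forall w, f w != 0%N) -> path (edge G) u s ->
  f u = x.+1 -> f (last u s) = y.+1 ->
  (spdist eH lH x y <= (walk_len (fun v w => code_dist G (f v) (f w)) u s)%:E)%E.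
Proof.
move=> f0 ps fu fl.
suff [t [pt lt wt]] : exists t, [/\ path eH x t, last x t = y &
    walk_len lH x t = walk_len (fun v w => code_dist G (f v) (f w)) u s].
  by rewrite -wt; apply: ereal_inf_lbound; exists t.
elim: s u x ps fu fl => [|v s IH] u x /=.
  by move=> _ -> [/ord_inj ->]; exists [::].
move=> /andP[uv ps] fu fl.
have [z [_ fv _]] := assignment_dist f_assigns (f0 v).
have [t [pt lt wt]] := IH v z ps fv fl.
have [xz|xz] := eqVneq x z.
  by exists t; rewrite xz pt lt wt fu fv xz code_distE gdistxx// add0r.
have e : eH x z by apply/eHP; exists u, v.
by exists (z :: t); rewrite /= e pt lt wt fu fv code_distE lHE.
Qed.

End ContractedGraph.

Lemma extends_all_assigned (R : realType) n (G : wgraph R n) f f' u v :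
  connected_graph G -> extends G (fun=> 0%N) f f' -> f' u != 0%N -> f' v != 0%N.
Proof.
move=> conn ext fu; have /connectP[s ps ->] := conn u v.
elim: s u ps fu => //= w s IH u /andP[uw /IH ws] fu.
by apply: ws; apply: (extends_closed ext uw erefl fu).
Qed.

(** * The whole program *)

Definition init_assignment_cmd : cmd :=
  loop 10 (If (NLe (NConst 1) (nentry 2 10))
    (NSet 5 (nvar 10) (NConst 0) (NAdd (nvar 10) (NConst 1))) Skip).

Definition init_cmd : cmd :=
  Seq distances_cmd (Seq init_assignment_cmd next_scale_cmd).

Definition init_time (n : nat) : nat :=
  (distances_time n + (loop_time 3 n + next_scale_time n).+1).+1.

Definition output_step_cmd : cmd :=
  If (BAnd (edge_test 10 11) (BNot (NEq (nentry 5 10) (nentry 5 11))))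
    (NSet 3 (NSub (nentry 5 10) (NConst 1)) (NSub (nentry 5 11) (NConst 1)) (NConst 1))
    Skip.

Definition final_cmd : cmd :=
  Seq (spread_cmd 9) (loop 10 (loop 11 output_step_cmd)).

Definition final_time (n : nat) : nat :=
  (spread_time n + loop_time (loop_time 3 n) n).+1.

Definition sparsifier_cmd : cmd := Seq init_cmd (Seq main_loop_cmd final_cmd).

Definition sparsifier_time (p : {poly nat}) (n : nat) : nat :=
  (init_time n + (final_time n + 1 + n * n * level_time n p).+1).+1.

Section Assembly.
Variables (R : realType) (n : nat) (G : wgraph R n) (K : {set 'I_n}).
Hypothesis G_connected : connected_graph G.
Implicit Types (m : store R) (u v w x y : 'I_n).

Lemma wp_init_assignment m0 : narr m0 0 0 0 = n ->
  (forall u, narr m0 2 u 0 = (u \in K)) -> narr m0 5 = (fun _ _ => 0%N) ->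
  wp init_assignment_cmd (loop_time 3 n)
    (fun m => column 5 m = initial_assignment K) m0.
Proof.
move=> n0 K0 z0.
pose I i m := forall u, column 5 m u = if (u < i)%N then initial_assignment K u else 0%N.
apply: (@wp_conseq _ _ (loop_time 3 n) _ (I n)) => //; last first.
  by move=> m _ Im; apply/funext => u; rewrite Im ltn_ord.
apply: (@wp_loop _ 10%N _ n _ I) => //; first by move=> u; rewrite /column z0.
move=> i m ltin A mi Im; apply: (wp_straight_line (c := If _ _ _)) => // u.
have -> : effect (If (NLe (NConst 1) (nentry 2 10))
    (NSet 5 (nvar 10) (NConst 0) (NAdd (nvar 10) (NConst 1))) Skip) m =
  if Ordinal ltin \in K then nset m 5 i 0 i.+1 else m.
  by rewrite /= mi (A.1 2%N)// (K0 (Ordinal ltin)) lt0b addn1.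
have [/eqP ui|ui] := boolP ((u : nat) == i).
  have uo : u = Ordinal ltin by apply/val_inj.
  rewrite ui ltnS leqnn /initial_assignment -uo; case: ifP => uK.
    by rewrite /column /= upd_eq ui eqxx.
  by rewrite Im ui ltnn.
have -> : column 5 (if Ordinal ltin \in K then nset m 5 i 0 i.+1 else m) u = column 5 m u.
  case: (Ordinal ltin \in K) => //.
  by rewrite /column /= upd_eq (negbTE ui).
by have -> : (u < i.+1)%N = (u < i)%N by move/eqP: ui; lia.
Qed.

Lemma wp_init : wp init_cmd (init_time n)
  (fun m => [/\ loop_state G K m, rarr m 4 0 0 = 0 & column 5 m = initial_assignment K])
  (graph_input G K).
Proof.
set m0 := graph_input G K.
have n0 : narr m0 0 0 0 = n by [].
have adj0 u v : narr m0 1 u v = edge G u v by rewrite /m0 /= /matr !valK.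
have K0 u : narr m0 2 u 0 = (u \in K) by rewrite /m0 /= valK.
have len0 : lengths_stored G m0 by move=> u v; rewrite /m0 /= /matr !valK.
apply: wp_seq.
apply: (wp_conseq (wp_distances G_connected (conj n0 adj0) len0 _ _)) => // m1 A1 M1.
apply: wp_seq.
have n1 : narr m1 0 0 0 = n by rewrite A1.1.
have K1 u : narr m1 2 u 0 = (u \in K) by rewrite A1.1.
apply: (wp_conseq (wp_init_assignment n1 K1 _)) => //; first by rewrite A1.1.
move=> m2 A2 f2.
have n2 : narr m2 0 0 0 = n by rewrite A2.1.
have M2 : rarr m2 1 = matr 0 (gdist G) by rewrite A2.2.
apply: (wp_conseq (wp_next_scale n2 M2)) => // m3 A3 found.
have [N RN] : agree_off init_cmd m0 m3.
  apply: (agree_off_trans (agree_off_sub _ _ A1)); [by apply/allP | by apply/allP | ].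
  apply: (agree_off_trans (agree_off_sub _ _ A2)); [by apply/allP | by apply/allP | ].
  by apply: (agree_off_sub _ _ A3); apply/allP.
have r3 : rarr m3 4 0 0 = 0 by rewrite RN.
have c3 : column 5 m3 = initial_assignment K by rewrite -f2 /column A3.1.
have r2 : rarr m2 4 0 0 = 0 by rewrite A2.2// A1.2.
split=> //; split; rewrite ?r3 ?c3 ?N//.
- by rewrite -M2; apply: A3.2.
- by move=> i j _; rewrite RN.
- exact: assignment_initial.
- by rewrite -r2.
Qed.

Definition contraction_stored m0 m : Prop :=
  exists2 f, extends G (fun=> 0%N) (column 5 m0) f &
    rarr m 1 = matr 0 (gdist G) /\
    forall i j, (narr m 3 i j != 0%N) <->
      exists u v, [/\ edge G u v, f u != f v, i = (f u).-1 & j = (f v).-1].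

Lemma wp_final m0 : loop_state G K m0 ->
  wp final_cmd (final_time n) (contraction_stored m0) m0.
Proof.
move=> st.
have n0 : narr m0 0 0 0 = n by rewrite (state_size st).
apply: wp_seq.
apply: (wp_conseq (@wp_spread _ _ G 9 m0 isT (conj n0 (state_adjacency st)))) => // m1 A1 ext.
set f := column 5 m1 in ext.
pose P i j := exists u v, [/\ edge G u v, f u != f v, i = (f u).-1 & j = (f v).-1].
pose I m := forall i j, narr m 3 i j != 0%N -> P i j.
pose Q a b m := forall u v, u = a :> nat -> v = b :> nat -> edge G u v -> f u != f v ->
  narr m 3 (f u).-1 (f v).-1 != 0%N.
have z0 : column 9 m0 = (fun=> 0%N) by rewrite /column (state_zero st).
apply: (@wp_conseq _ _ (loop_time (loop_time 3 n) n) _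
  (fun m => I m /\ forall i j, (i < n)%N -> (j < n)%N -> Q i j m)) => //; last first.
  move=> m A2 [Im Qm]; exists f; first by rewrite -z0.
  split; first by rewrite A2.2// A1.2// (state_distances st).
  move=> i j; split=> [/Im//|[u [v [uv fuv -> ->]]]].
  exact: (Qm u v (ltn_ord u) (ltn_ord v) u v).
apply: (@wp_loop2 _ 10%N 11%N _ n _ I Q) => //.
- by move=> v k m; rewrite !inE => /orP[]/eqP-> Im i j; apply: Im.
- by move=> v k m i j; rewrite !inE => /orP[]/eqP-> q u w; apply: q.
- by rewrite A1.1.
- by move=> i j; rewrite A1.1// (state_output st).
move=> i j m ltin ltjn A mi mj Im.
apply: (wp_straight_line (c := output_step_cmd)) => //.
pose io := Ordinal ltin; pose jo := Ordinal ltjn.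
have E : effect output_step_cmd m =
    if edge G io jo && (f io != f jo) then nset m 3 (f io).-1 (f jo).-1 1 else m.
  rewrite /= mi mj (A.1 1%N)// (A1.1 1%N)// (state_adjacency st io jo) lt0b.
  by rewrite (A.1 5%N)// -eqn_leq !subn1.
rewrite E; case: ifP => [/andP[e fij]|c]; last first.
  split=> // u v ui vj uv fuv; move: c.
  have <- : u = io by apply/val_inj.
  have <- : v = jo by apply/val_inj.
  by rewrite uv fuv.
split.
- move=> i' j'; rewrite /= upd_eq; case: ifP => [/andP[/eqP-> /eqP->] _|_ /Im//].
  by exists io, jo.
- move=> u v ui vj _ _.
  have -> : u = io by apply/val_inj.
  have -> : v = jo by apply/val_inj.
  by rewrite /= upd_eq !eqxx.
- move=> i' j' q u v ui vj uv fuv; rewrite /= upd_eq; case: ifP => // _.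
  exact: q.
Qed.

Lemma contraction_edges m0 m r f :
  assignment G K (column 5 m0) r -> 0 <= r -> last_scale G r ->
  extends G (fun=> 0%N) (column 5 m0) f ->
  (forall i j, (narr m 3 i j != 0%N) <->
      exists u v, [/\ edge G u v, f u != f v, i = (f u).-1 & j = (f v).-1]) ->
  assignment G K f (2 * r) /\
  forall x y, out_edge m x y <-> contracted_edge G f x y.
Proof.
move=> af r0 last ext outP.
have D := last_scale_diam G_connected (lab := fun=> 0%N) r0 last.
have af' : assignment G K f (2 * r) by apply: assignment_extends af D _ ext.
split=> // x y; rewrite /out_edge; split=> [/outP[u [v [uv fuv xE yE]]]|].
  (* Different codes cannot both be zero, so by connectivity neither is, and the predecessors
     determine them. *)
  have [fu fv] : f u != 0%N /\ f v != 0%N.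
    have [fu|fu] := eqVneq (f u) 0%N; last first.
      by split=> //; apply: extends_all_assigned ext fu.
    have fv : f v != 0%N by rewrite eq_sym -fu.
    by have := extends_all_assigned u G_connected ext fv; rewrite fu.
  have fuE : f u = x.+1 by rewrite xE prednK// lt0n.
  have fvE : f v = y.+1 by rewrite yE prednK// lt0n.
  exists u, v; split=> //; apply: contraNneq fuv => xy.
  by rewrite fuE fvE xy.
move=> [u [v [uv fu fv xy]]]; apply/outP; exists u, v; rewrite fu fv; split=> //.
Qed.

Variables (D : cmd) (p : {poly nat}) (beta : R).
Hypothesis D_decomposes : decomposable D p beta (gdist G).

Let m_in := graph_input G K.
Let T := sparsifier_time p n.

Definition valid_output m : Prop :=
  is_minor G K (out_edge m) /\
  forall x y, out_edge m x y -> out_len m x y = gdist G x y.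

(* The cost is [+oo] unless the program halts with a valid output, so a finite
   bound gives halting, validity and the expected cost at once. *)
Definition checked_cost (cost : store R -> \bar R) (s : config R) : \bar R :=
  if `[< s.1 = [::] /\ valid_output s.2 >] then cost s.2 else +oo%E.

(** Used twice: zero cost and potential give halting and validity, the potential of a shortest walk
    gives the expected distance. *)
Lemma fexpect_sparsifier (Phi : R -> ('I_n -> nat) -> R) (cost : store R -> \bar R) :
  (forall m, 0 <= cost m)%E ->
  supermartingale G K beta Phi ->
  (forall m r f f', 0 <= r -> assignment G K f r -> last_scale G r ->
     extends G (fun=> 0%N) f f' -> assignment G K f' (2 * r) ->
     (forall x y, out_edge m x y <-> contracted_edge G f' x y) ->
     (forall x y, out_len m x y = gdist G x y) ->
     (cost m <= (Phi r f)%:E)%E) ->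
  (fexpect (run D sparsifier_cmd m_in T) (checked_cost cost) <=
   (Phi 0 (initial_assignment K))%:E)%E.
Proof.
move=> cost0 super costP.
have F0 s : (0 <= checked_cost cost s)%E by rewrite /checked_cost; case: ifP.
rewrite fexpect_run//.
pose T1 := (init_time n + (final_time n + 1 + n * n * level_time n p).+1)%N.
have -> : ev D T (checked_cost cost) ([:: Do R sparsifier_cmd], m_in) =
    ev D T1 (checked_cost cost) ([:: Do R init_cmd; Do R (Seq main_loop_cmd final_cmd)], m_in).
  exact: fexpect_fret.
have [m1 [t1 [E1 le1 [st1 r1 f1]]]] := wp_init.
have [T2 TE leT2] : exists2 T2, T1 = (t1 + T2.+1)%N &
    (final_time n + 1 + n * n * level_time n p <= T2)%N.
  by exists (init_time n - t1 + (final_time n + 1 + n * n * level_time n p))%N;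
    rewrite ?leq_addl// addnS addnA subnKC// -addnS.
rewrite TE (exec_ev _ E1) /= fexpect_fret -r1 -f1.
apply: (ev_main_loop G_connected D_decomposes F0 super (T0 := final_time n)
  _ st1 (candidates_le _ _)).
  move=> m st last T3 leT3.
  have [m2 [t2 [E2 le2 [f' ext [M2 out2]]]]] := wp_final st.
  have [T4 ->] : exists T4, T3 = (t2 + T4)%N by exists (T3 - t2)%N; lia.
  rewrite (exec_ev _ E2) ev_halted.
  have r0 := state_scale_ge0 st; have af := state_assignment st.
  have [af' edges] := contraction_edges af r0 last ext out2.
  have lens x y : out_len m2 x y = gdist G x y by rewrite /out_len M2 /matr !valK.
  rewrite /checked_cost asboolT /=; first exact: costP ext af' edges lens.
  split=> //; split=> // /=.
  exact: is_minor_contracted af' edges.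
exact: leT2.
Qed.

Lemma sparsifier_valid :
  almost_surely (run D sparsifier_cmd m_in T)
    (fun s => s.1 = [::] /\ valid_output s.2).
Proof.
have nn := nonneg_weights_run D sparsifier_cmd m_in T.
have [||] := @almost_surely_fexpect _ _ _ (fun s => s.1 = [::] /\ valid_output s.2)
  (fun=> 0%E) nn => //.
apply: (@le_lt_trans _ _ 0%E); last exact: ltry.
apply: (@fexpect_sparsifier (fun _ _ => 0) (fun=> 0%E)) => //.
move=> r rp f T' mu lab _ _ _ _ _ _; exists (fun=> 0); split=> //.
by rewrite fexpect_cst mulr0.
Qed.

Lemma sparsifier_halts : halts_within D sparsifier_cmd m_in T.
Proof. by apply: almost_surely_imp sparsifier_valid => s []. Qed.

Lemma sparsifier_outcome_valid :
  almost_surely (outcome D sparsifier_cmd m_in T) valid_output.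
Proof. by apply/almost_surely_fmap; apply: almost_surely_imp sparsifier_valid => s []. Qed.

Lemma sparsifier_expect_ge x y :
  ((gdist G x y)%:E <= fexpect (outcome D sparsifier_cmd m_in T) (fun m => out_dist m x y))%E.
Proof.
rewrite /outcome fexpect_fmap.
have <- : fexpect (run D sparsifier_cmd m_in T) (fun=> (gdist G x y)%:E) = (gdist G x y)%:E.
  by rewrite fexpect_cst weight_run mul1r.
apply: le_fexpect; first exact: nonneg_weights_run.
apply: almost_surely_imp sparsifier_valid => s [_ [_ lens]].
exact: gdist_le_spdist.
Qed.

Lemma sparsifier_expect_le x y : 2 <= beta -> x \in K -> y \in K ->
  (fexpect (outcome D sparsifier_cmd m_in T) (fun m => out_dist m x y) <=
   (322 / ln 2 * (beta * ln beta) * gdist G x y)%:E)%E.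
Proof.
move=> beta2 xK yK.
have [s [ps ls _ <-]] := gdist_walk G_connected x y.
have K0 : K != finset.set0 by apply/set0Pn; exists x.
have [Phi [super exit init]] := walk_supermartingale G_connected beta2 ps K0.
(* An arbitrary store may hold negative lengths; the maximum makes the cost nonnegative
   everywhere. *)
pose cost m := maxe 0%E (out_dist m x y).
apply: (@le_trans _ _ (fexpect (run D sparsifier_cmd m_in T) (checked_cost cost))).
  rewrite /outcome fexpect_fmap; apply: le_fexpect; first exact: nonneg_weights_run.
  apply: almost_surely_imp sparsifier_valid => c cP.
  by rewrite /checked_cost asboolT// /cost le_max lexx orbT.
apply: le_trans (_ : (_ <= (Phi 0 (initial_assignment K))%:E)%E) _; last by rewrite lee_fin.
apply: fexpect_sparsifier => //; first by move=> m; rewrite /cost le_max lexx.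
move=> m r f f' r0 af lastr ext af' edges lens.
have lens' u v : out_edge m u v -> out_len m u v = gdist G u v by [].
have fx : f' x = x.+1 := assignment_terminal af' xK.
have fy : f' (last x s) = y.+1 by rewrite ls (assignment_terminal af').
have all0 w : f' w != 0%N.
  by apply: (extends_all_assigned w G_connected ext (u := x)); rewrite fx.
have le := spdist_le_walk G_connected af' edges lens' all0 ps fx fy.
have := exit r f f' r0 af lastr ext; rewrite -lee_fin => /(le_trans le) leP.
rewrite /cost ge_max leP andbT; apply: le_trans leP.
apply: le_trans (gdist_le_spdist G_connected lens' x y).
by rewrite lee_fin gdist_ge0.
Qed.

End Assembly.

(** * Polynomial bound on the running time *)

Definition polynomial_time (t : nat -> nat) : Prop :=
  exists q : {poly nat}, forall n, t n = q.[n].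

Lemma polynomial_time_cst c : polynomial_time (fun=> c).
Proof. by exists c%:P => n; rewrite hornerC. Qed.

Lemma polynomial_time_id : polynomial_time id.
Proof. by exists 'X => n; rewrite hornerX. Qed.

Lemma polynomial_timeD t1 t2 : polynomial_time t1 -> polynomial_time t2 ->
  polynomial_time (fun n => t1 n + t2 n)%N.
Proof. by move=> [q1 E1] [q2 E2]; exists (q1 + q2) => n; rewrite hornerD E1 E2. Qed.

Lemma polynomial_timeM t1 t2 : polynomial_time t1 -> polynomial_time t2 ->
  polynomial_time (fun n => t1 n * t2 n)%N.
Proof. by move=> [q1 E1] [q2 E2]; exists (q1 * q2) => n; rewrite hornerM E1 E2. Qed.

Lemma polynomial_timeS t : polynomial_time t -> polynomial_time (fun n => (t n).+1).
Proof.
move=> /polynomial_timeD/(_ (polynomial_time_cst 1))[q E].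
by exists q => n; rewrite -E addn1.
Qed.

Lemma polynomial_time_loop t : polynomial_time t ->
  polynomial_time (fun n => loop_time (t n) n).
Proof.
move=> ht; do ?[apply: polynomial_timeD | apply: polynomial_timeM];
  by [apply: polynomial_time_id | apply: polynomial_time_cst | ].
Qed.

Lemma polynomial_time_sparsifier (p : {poly nat}) : polynomial_time (sparsifier_time p).
Proof.
have hp : polynomial_time (fun n => p.[n]) by exists p.
have hid := polynomial_time_id; have hc := polynomial_time_cst.
have loop3 : polynomial_time (fun n => loop_time (loop_time 3 n) n).
  by apply: polynomial_time_loop; apply: polynomial_time_loop.
have loop4 : polynomial_time (fun n => loop_time (loop_time (loop_time (loop_time 3 n) n) n) n).
  by apply: polynomial_time_loop; apply: polynomial_time_loop.
have hnext : polynomial_time next_scale_time.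
  by apply: polynomial_timeS; apply: polynomial_timeD.
have hafter : polynomial_time after_call_time.
  apply: polynomial_timeS; apply: polynomial_timeD => //.
  by apply: polynomial_timeS; apply: polynomial_timeD.
have hdist : polynomial_time distances_time.
  apply: polynomial_timeS; apply: polynomial_timeD.
    by apply: polynomial_time_loop; apply: polynomial_time_loop.
  apply: polynomial_timeS; apply: polynomial_timeD => //.
  by apply: polynomial_time_loop; apply: polynomial_time_loop.
have hfinal : polynomial_time final_time.
  by apply: polynomial_timeS; apply: polynomial_timeD.
have hinit : polynomial_time init_time.
  apply: polynomial_timeS; apply: polynomial_timeD => //.
  by apply: polynomial_timeS; apply: polynomial_timeD => //; apply: polynomial_time_loop.
have hlevel : polynomial_time (fun n => level_time n p).
  by apply: polynomial_timeD => //; apply: polynomial_timeD.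
apply: polynomial_timeS; apply: polynomial_timeD => //.
apply: polynomial_timeS; apply: polynomial_timeD; first exact: polynomial_timeD.
by apply: polynomial_timeM => //; apply: polynomial_timeM.
Qed.

Theorem theorem4p3 (R : realType) :
  exists (A : cmd) (C : R),
  forall (D : cmd) (p : {poly nat}),
  exists q : {poly nat},
  forall (n : nat) (G : wgraph R n) (K : {set 'I_n}) (beta : R),
    connected_graph G ->
    2 <= beta ->
    decomposable D p beta (gdist G) ->
    let m0 := graph_input G K in
    let mu := outcome D A m0 q.[n] in
    [/\ halts_within D A m0 q.[n],
        almost_surely mu (fun m =>
          is_minor G K (out_edge m) /\
          forall x y : 'I_n, out_edge m x y -> out_len m x y = gdist G x y) &
        forall x y : 'I_n, x \in K -> y \in K -> 0 < gdist G x y ->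
          (1%:E <= fexpect mu (fun m => out_dist m x y) / (gdist G x y)%:E
             <= (C * (beta * ln beta))%:E)%E].
Proof.
exists sparsifier_cmd, (322 / ln 2) => D p.
have [q qE] := polynomial_time_sparsifier p.
exists q => n G K beta conn beta2 dec m0 mu; rewrite /mu -qE.
split.
- exact: (sparsifier_halts K conn dec).
- exact: (sparsifier_outcome_valid K conn dec).
move=> x y xK yK xy0.
set E := fexpect _ _.
have lo : ((gdist G x y)%:E <= E)%E by apply: (sparsifier_expect_ge K conn dec x y).
have hi := sparsifier_expect_le conn dec beta2 xK yK; rewrite -/E in hi.
(* Finiteness turns the quotient in the extended reals into a real one. *)
have Efin : E \is a fin_num.
  rewrite ge0_fin_numE; first exact: le_lt_trans hi (ltry _).
  by apply: le_trans lo; rewrite lee_fin ltW.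
move: lo hi; rewrite -(fineK Efin) !lee_fin inver gt_eqF// -EFinM !lee_fin.
by move=> lo hi; rewrite ler_pdivlMr// mul1r lo ler_pdivrMr.
Qed.
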